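(* Let $p$ be an odd prime and let $m,n,s$ be positive integers with $1\le m<p/2$. Then \[ p^{2sn}\tilde J_{2s+2}(mp^n)\equiv p^{2s(n-1)}\tilde J_{2s+2}(mp^{n-1})\pmod{p^n}. \]
   Context: For $k\ge2$, $n\ge0$: $J_k(n)=\sum_{r=1}^{k-1}2^k\int_{[0,1]^k}\frac{(1-u_1^4\cdots u_r^4)^n(1-u_{r+1}^4\cdots u_k^4)^n}{(1-u_1^2\cdots u_k^2)^{2n+1}}du_1\cdots du_k$; $J_0(n)=0$; $J_1(n)=\frac{2^nn!}{(2n+1)!!}$. The normalized (rational) numbers $\tilde J_k(n)$ are defined inductively by $\tilde J_1(n)=J_1(n)$ and, for $s\ge1$, $J_{2s}(n)=\sum_{j=0}^{s-1}J_{2s-2j}(0)\tilde J_{2j+2}(n)$ and $J_{2s+1}(n)=\sum_{j=0}^{s-1}J_{2s+1-2j}(0)\tilde J_{2j+2}(n)+\tilde J_{2s+1}(n)$. For rational numbers $a,b$, $a\equiv b\pmod{p^n}$ means that $a-b$ has $p$-adic valuation at least $n$. *)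

(* Defs.v *)
From HB Require Import structures.
From mathcomp Require Import all_boot all_order all_algebra.
From mathcomp Require Import all_classical all_reals all_analysis.

Set Implicit Arguments.
Unset Strict Implicit.
Unset Printing Implicit Defensive.

Import Order.TTheory GRing.Theory Num.Theory.
Import numFieldNormedType.Exports.

Local Open Scope classical_set_scope.
Local Open Scope ring_scope.

Definition cons_tuple_pair (T : Type) (k : nat) (z : T * k.-tuple T) :
  k.+1.-tuple T := [tuple of z.1 :: z.2].

(* k-dimensional Lebesgue measure on the Borel sets of R^k, as an iterated
   product measure transported along R * R^k ~ R^(k+1). *)
Fixpoint lebesgue_tuple (R : realType) (k : nat) :
    set (k.-tuple (measurableTypeR R)) -> \bar R :=
  match k with
  | 0 => dirac [tuple]
  | k'.+1 => pushforward (lebesgue_measure \x lebesgue_tuple (k := k'))%E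
               (@cons_tuple_pair (measurableTypeR R) k')
  end.
Arguments lebesgue_tuple R k : clear implicits.

Lemma measurable_cons_tuple_pair d (T : measurableType d) k :
  measurable_fun [set: T * k.-tuple T] (@cons_tuple_pair T k).
Proof. exact: measurable_cons. Qed.

Lemma measurable_uncons_tuple d (T : measurableType d) k :
  measurable_fun [set: k.+1.-tuple T]
    (fun t => (thead t, [tuple of behead t])).
Proof.
apply/measurable_fun_pairP; split.
  exact: (@measurable_tnth _ T k.+1 ord0).
exact: measurable_behead.
Qed.

Lemma pushforward_cons_measure (R : realType) k
    (m : {measure set (measurableTypeR R * k.-tuple (measurableTypeR R))%type -> \bar R}) :
  let p := pushforward m (@cons_tuple_pair (measurableTypeR R) k) in
  [/\ p set0 = 0%E, forall A, (0 <= p A)%E & semi_sigma_additive p].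
Proof.
have mc := @measurable_cons_tuple_pair _ (measurableTypeR R) k.
split.
- by rewrite /pushforward preimage_set0 measure0.
- by move=> A; exact: measure_ge0.
- move=> F mF tF mUF; rewrite /pushforward preimage_bigcup.
  apply: measure_semi_sigma_additive.
  + by move=> n; rewrite -[X in measurable X]setTI; exact: mc.
  + apply/trivIsetP => /= i j _ _ ij; rewrite -preimage_setI.
    by move/trivIsetP : tF => /(_ _ _ _ _ ij) ->//; rewrite preimage_set0.
  + by rewrite -preimage_bigcup -[X in measurable X]setTI; exact: mc.
Qed.

Lemma pushforward_cons_sigma_finite (R : realType) k
    (mu : {sigma_finite_measure set (k.-tuple (measurableTypeR R)) -> \bar R}) :
  sigma_finite setT (pushforward (lebesgue_measure \x mu)%E
                       (@cons_tuple_pair (measurableTypeR R) k)).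
Proof.
have mg := @measurable_uncons_tuple _ (measurableTypeR R) k.
pose g (t : k.+1.-tuple (measurableTypeR R)) := (thead t, [tuple of behead t]).
have /sigma_finiteP[F [TF ndF Foo]] := sigma_finiteT (@lebesgue_measure R).
have /sigma_finiteP[G [TG ndG Goo]] := sigma_finiteT mu.
exists (fun n => g @^-1` (F n `*` G n)).
  rewrite -preimage_bigcup; apply/esym; rewrite -subTset => t _ /=.
  have [i _ Fi] : (\bigcup_i F i) (g t).1 by rewrite -TF.
  have [j _ Gj] : (\bigcup_i G i) (g t).2 by rewrite -TG.
  exists (maxn i j) => //; split.
  - by move: Fi; exact/subsetPset/ndF/leq_maxl.
  - by move: Gj; exact/subsetPset/ndG/leq_maxr.
move=> i; have [mF Fi] := Foo i; have [mG Gi] := Goo i; split.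
  by rewrite -[X in measurable X]setTI; apply: mg => //; exact: measurableX.
rewrite /pushforward -comp_preimage (_ : g \o _ = id).
  rewrite preimage_id product_measure1E// lte_mul_pinfty//.
  by rewrite ge0_fin_numE.
apply/funext => -[x t]; rewrite /g/= /cons_tuple_pair/= theadE; congr pair.
exact: val_inj.
Qed.

Lemma lebesgue_tuple_measureP (R : realType) k :
  [/\ lebesgue_tuple R k set0 = 0%E,
      forall A, (0 <= lebesgue_tuple R k A)%E,
      semi_sigma_additive (lebesgue_tuple R k) &
      sigma_finite setT (lebesgue_tuple R k)].
Proof.
elim: k => [|k [mu0 mu_ge0 mu_add mu_fin]].
  split=> //=; [exact: measure_semi_sigma_additive|exact: sigma_finiteT].
pose M := isMeasure.Build _ _ _ (lebesgue_tuple R k) mu0 mu_ge0 mu_add.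
pose m : {measure set (k.-tuple (measurableTypeR R)) -> \bar R} :=
  HB.pack (lebesgue_tuple R k) M.
pose F := Measure_isSigmaFinite.Build _ _ _ m mu_fin.
pose mu : {sigma_finite_measure set (k.-tuple (measurableTypeR R)) -> \bar R} :=
  HB.pack (Measure.sort m) F.
have [p0 p_ge0 p_add] := pushforward_cons_measure (lebesgue_measure \x mu)%E.
have pfin := @pushforward_cons_sigma_finite R k mu.
by split.
Qed.

Lemma lebesgue_tuple0 (R : realType) k : lebesgue_tuple R k set0 = 0%E.
Proof. by have [] := lebesgue_tuple_measureP R k. Qed.

Lemma lebesgue_tuple_ge0 (R : realType) k A : (0 <= lebesgue_tuple R k A)%E.
Proof. by have [] := lebesgue_tuple_measureP R k. Qed.

Lemma lebesgue_tuple_semi_sigma_additive (R : realType) k :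
  semi_sigma_additive (lebesgue_tuple R k).
Proof. by have [] := lebesgue_tuple_measureP R k. Qed.

Lemma lebesgue_tuple_sigma_finite (R : realType) k :
  sigma_finite setT (lebesgue_tuple R k).
Proof. by have [] := lebesgue_tuple_measureP R k. Qed.

HB.instance Definition _ (R : realType) k :=
  isMeasure.Build _ _ _ (lebesgue_tuple R k) (lebesgue_tuple0 R k)
    (@lebesgue_tuple_ge0 R k) (@lebesgue_tuple_semi_sigma_additive R k).

HB.instance Definition _ (R : realType) k :=
  Measure_isSigmaFinite.Build _ _ _ (lebesgue_tuple R k)
    (lebesgue_tuple_sigma_finite R k).

Lemma lebesgue_tuple_box (R : realType) k (A : 'I_k -> set (measurableTypeR R)) :
  (forall i, measurable (A i)) ->
  lebesgue_tuple R k [set u | forall i, A i (tnth u i)] =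
  (\prod_(i < k) lebesgue_measure (A i))%E.
Proof.
elim: k A => [|k IH] A mA.
  rewrite big_ord0 /= diracE mem_set//; first by move=> [].
rewrite big_ord_recl -IH; last by move=> i; exact: mA.
rewrite -product_measure1E//; last first.
  pose B i := [set u : k.-tuple (measurableTypeR R) | A (lift ord0 i) (tnth u i)].
  rewrite (_ : mkset _ = \bigcap_(i in [set: 'I_k]) B i); last first.
    by apply/seteqP; split=> u /= Bu i *; exact: Bu.
  apply: fin_bigcap_measurable => [|i _]; first exact: finite_finset.
  rewrite -[X in measurable X]setTI.
  exact: (@measurable_tnth _ (measurableTypeR R) k i).
rewrite /= /pushforward; congr product_measure1.
apply/seteqP; split=> -[x u] /=.
  move=> Au; split; first exact: (Au ord0).
  by move=> i; have := Au (lift ord0 i); rewrite /cons_tuple_pair tnthS.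
move=> [Ax Au] i; case: (unliftP ord0 i) => [j ->|->//].
by rewrite /cons_tuple_pair tnthS.
Qed.

Definition unit_cube (R : realType) (k : nat) : set (k.-tuple (measurableTypeR R)) :=
  [set u | forall i, tnth u i \in `[0, 1]].
Arguments unit_cube R k : clear implicits.

(* Summand of J_k(n) of index r: the coordinates u_1, ..., u_k of the text are
   tnth u 0, ..., tnth u (k - 1), so u_1, ..., u_r are those of index < r.  The
   integrand is nonnegative on the cube; its value at u = (1, ..., 1), where the
   denominator vanishes, is irrelevant. *)
Definition J_integrand (R : realType) (k r n : nat)
    (u : k.-tuple (measurableTypeR R)) : R :=
  (1 - \prod_(i < k | (i < r)%N) tnth u i ^+ 4) ^+ n *
  (1 - \prod_(i < k | (r <= i)%N) tnth u i ^+ 4) ^+ n /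
  (1 - \prod_(i < k) tnth u i ^+ 2) ^+ n.*2.+1.

Definition odd_double_factorial (n : nat) : nat := (\prod_(i < n.+1) i.*2.+1)%N.

Definition J (R : realType) (k n : nat) : R :=
  match k with
  | 0 => 0
  | 1 => (2 ^ n * n`!)%:R / (odd_double_factorial n)%:R
  | _ => \sum_(1 <= r < k)
           2 ^+ k * fine (\int[lebesgue_tuple R k]_(u in unit_cube R k)
                            (J_integrand r n u)%:E)%E
  end.

Definition normalized_J (R : realType) (tJ : nat -> nat -> R) : Prop :=
  [/\ forall n, tJ 1%N n = J R 1 n,
      forall s n, (1 <= s)%N ->
        J R s.*2 n =
        \sum_(0 <= j < s) J R (s.*2 - j.*2) 0 * tJ j.*2.+2 n &
      forall s n, (1 <= s)%N ->
        J R s.*2.+1 n =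
        \sum_(0 <= j < s) J R (s.*2.+1 - j.*2) 0 * tJ j.*2.+2 n
        + tJ s.*2.+1 n].

(* Only meaningful for q != 0. *)
Definition padic_val (p : nat) (q : rat) : int :=
  (logn p `|numq q|)%:Z - (logn p `|denq q|)%:Z.

Definition congr_rat (p n : nat) (a b : rat) : Prop :=
  a = b \/ n%:Z <= padic_val p (a - b).

(* Congruence of real numbers: both must be rational. *)
Definition congr_mod_pow (R : realType) (p n : nat) (x y : R) : Prop :=
  exists a b : rat, [/\ x = ratr a, y = ratr b & congr_rat p n a b].

(* Main.v *)
From HB Require Import structures.
Require Import Defs.
From mathcomp Require Import all_boot all_order all_algebra.
From mathcomp Require Import all_classical all_reals all_analysis.
From mathcomp Require Import measurable_realfun.
From mathcomp Require Import ring lra zify.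
From mathcomp Require cyclic.

(** With X and Y the products of the squares of the first r and of the last
    k - r coordinates, (1 - X^2) (1 - Y^2) = (1 - X Y)^2 - (X - Y)^2, so the
    integrand of J_k(n) is sum_i (-1)^i C(n,i) H_i with
    H_i = (X - Y)^(2i) / (1 - X Y)^(2i+1).  Expanding H_i in powers of X Y and
    summing over r, the integral of H_i is the coefficient of y^(k-2) in a
    series sum_l t_i(l), where t_i(l) is hypergeometric in l with poles of
    the form 1 / (2j + 1 - y).  A Gosper certificate telescopes
    (2i+2)^2 t_(i+1) - ((2i+1)^2 - y^2) t_i, and its limit is a multiple of y,
    hence invisible in even degrees.  Therefore, with z = y / 2,
      J_(2s+2)(n) = sum_j J_(2s+2-2j)(0) [z^(2j)] b_n(z),
      b_n(z) = sum_i (-1)^i C(n,i) prod_(h<i) ((2h+1)^2 - 4 z^2) / (2h+2)^2,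
    and the normalized number of index 2j + 2 is the coefficient [z^(2j)] b_n.

    The congruence is then proved term by term in i.  After the substitution
    z^2 := p^(2n) z^2 the i-th term is p-integral.  Modulo p^n only the
    multiples i = p i' contribute, and the term of index p i' for (m p^n, n)
    is congruent to the term of index i' for (m p^(n-1), n-1). *)

Set Implicit Arguments.
Unset Strict Implicit.
Unset Printing Implicit Defensive.
Import Order.TTheory GRing.Theory Num.Theory.
Import numFieldNormedType.Exports.
Local Open Scope ring_scope.

(** * Congruences of polynomials over the local ring at p *)

Definition p_integral (p : nat) : {pred rat} := [pred q | coprime p `|denq q|].

(** Any denominator prime to [p] will do, reduced or not, which makes the closure properties
    immediate: [denq q] is prime to [numq q], hence divides [d]. *)
Lemma p_integralP p q :
  reflect (exists2 d : nat, coprime p d & exists z : int, q * d%:R = z%:~R)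
          (q \in p_integral p).
Proof.
apply: (iffP idP) => [pq|[d pd [z qd]]].
  exists `|denq q|%N => //; exists (numq q).
  by rewrite numqE natr_absz ger0_norm ?denq_ge0.
rewrite inE; apply: coprime_dvdr pd.
have : (denq q %| numq q * d)%Z.
  apply/dvdzP; exists z; apply/eqP; rewrite -(eqr_int rat) !rmorphM /= -qd.
  by rewrite mulrAC numqE.
rewrite Gauss_dvdzr; last by rewrite coprimezE coprime_sym coprime_num_den.
by rewrite dvdzE absz_nat.
Qed.

Lemma p_integral_subring p : subring_closed (p_integral p).
Proof.
split.
- by apply/p_integralP; exists 1%N; [exact: coprimen1|exists 1; rewrite mulr1].
- move=> a b /p_integralP[d pd [y ad]] /p_integralP[e pe [z be]].
  apply/p_integralP; exists (d * e)%N; first by rewrite coprimeMr pd.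
  exists (y * e%:Z - z * d%:Z).
  rewrite natrM rmorphB !rmorphM /= -ad -be -!pmulrn; ring.
- move=> a b /p_integralP[d pd [y ad]] /p_integralP[e pe [z be]].
  apply/p_integralP; exists (d * e)%N; first by rewrite coprimeMr pd.
  by exists (y * z); rewrite natrM rmorphM /= -ad -be mulrACA.
Qed.

HB.instance Definition _ p :=
  GRing.isSubringClosed.Build rat (p_integral p) (p_integral_subring p).

Lemma p_integral_natV p d : coprime p d -> d%:R^-1 \in p_integral p.
Proof.
move=> pd; apply/p_integralP; exists d => //.
case: d pd => [|d] pd; first by exists 0; rewrite mulr0.
by exists 1; rewrite mulVf ?pnatr_eq0.
Qed.

(** Only the difference is constrained, so a congruence can be stated before either side is known to
    be [p]-integral. *)
Definition congp (p n : nat) (f g : {poly rat}) :=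
  exists2 h, h \is a polyOver (p_integral p) & f - g = (p%:R ^+ n) *: h.

Lemma congp_refl p n f : congp p n f f.
Proof. by exists 0; rewrite ?rpred0// subrr scaler0. Qed.

Lemma congpD p n f g f' g' :
  congp p n f g -> congp p n f' g' -> congp p n (f + f') (g + g').
Proof.
move=> [a pa fg] [b pb gh]; exists (a + b); first exact: rpredD.
by rewrite scalerDr -fg -gh opprD addrACA.
Qed.

Lemma congp_sum p n (I : Type) (r : seq I) (P : pred I) (F G : I -> {poly rat}) :
  (forall i, P i -> congp p n (F i) (G i)) ->
  congp p n (\sum_(i <- r | P i) F i) (\sum_(i <- r | P i) G i).
Proof.
move=> FG; elim/big_ind2 : _ => //; first exact: congp_refl.
by move=> *; exact: congpD.
Qed.

Lemma congpW p m n f g : (m <= n)%N -> congp p n f g -> congp p m f g.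
Proof.
move=> mn [h ph fg]; exists (p%:R ^+ (n - m) *: h).
  by apply: polyOverZ => //; rewrite rpredX// rpred_nat.
by rewrite fg scalerA -exprD subnKC.
Qed.

(** With this gain of precision, a binomial coefficient divisible by [p ^ i] compensates for a
    congruence known only modulo [p ^ j]. *)
Lemma congpMl p i j a f g : a \is a polyOver (p_integral p) ->
  congp p j f g -> congp p (i + j) ((p%:R ^+ i *: a) * f) ((p%:R ^+ i *: a) * g).
Proof.
move=> pa [h ph fg]; exists (a * h); first exact: rpredM.
by rewrite -mulrBr fg -scalerAl -scalerAr scalerA exprD.
Qed.

Lemma congpM p n f g f' g' : f \is a polyOver (p_integral p) ->
  g' \is a polyOver (p_integral p) ->
  congp p n f g -> congp p n f' g' -> congp p n (f * f') (g * g').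
Proof.
move=> pf pg' [a pa fg] [b pb gh].
exists (a * g' + f * b); first by rewrite rpredD// rpredM.
by rewrite scalerDr scalerAl scalerAr -fg -gh; ring.
Qed.

Lemma congp_polyOver p n f g : g \is a polyOver (p_integral p) ->
  congp p n f g -> f \is a polyOver (p_integral p).
Proof.
move=> pg [h ph /(canRL (subrK _)) ->]; rewrite rpredD// polyOverZ//.
by rewrite rpredX// rpred_nat.
Qed.

Lemma polyOverC_nat p a : a%:R%:P \is a polyOver (p_integral p).
Proof. by rewrite polyOverC rpred_nat. Qed.

Lemma congp_prod1 p n (I : Type) (r : seq I) (P : pred I) (F : I -> {poly rat}) :
  (forall i, P i -> congp p n (F i) 1) ->
  congp p n (\prod_(i <- r | P i) F i) 1.
Proof.
move=> F1; elim/big_ind : _ => //; first exact: congp_refl.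
move=> f g f1 g1; rewrite -[1]mulr1; apply: congpM => //.
  by apply: congp_polyOver f1; exact: rpred1.
exact: rpred1.
Qed.

Lemma congp_nat_ratio p n (a b : nat) : (0 < p)%N -> coprime p b ->
  (0 < b)%N -> a = b %[mod p ^ n] -> congp p n (a%:R / b%:R)%:P 1.
Proof.
move=> p0 pb b0 ab.
have [c abc] : exists c : int, a%:Z - b%:Z = c * (p ^ n)%:Z.
  apply/dvdzP; rewrite -eqz_mod_dvd; apply/eqP.
  by rewrite !modz_nat ab.
exists (c%:~R / b%:R)%:P.
  by rewrite polyOverC rpredM ?rpred_int ?p_integral_natV.
rewrite -polyC1 -polyCB -mul_polyC -polyCM; congr polyC.
have /(congr1 (fun z : int => z%:~R : rat)) := abc.
rewrite rmorphB rmorphM /= -!pmulrn natrX => e.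
by rewrite mulrA [_ * c%:~R]mulrC -e mulrBl divff// pnatr_eq0 -lt0n.
Qed.

(** * Residue classes, factorials and binomial coefficients modulo powers of p *)

Lemma big_nat_residue (T : Type) (idx : T) (op : Monoid.com_law idx) (p c a : nat)
    (F : nat -> T) : (c < p)%N ->
  \big[op/idx]_(0 <= i < p * a | (i %% p == c)%N) F i =
  \big[op/idx]_(0 <= j < a) F (p * j + c)%N.
Proof.
move=> cp; elim: a => [|a IH]; first by rewrite muln0 !big_geq.
rewrite big_nat_recr//= -IH mulnS addnC (big_cat_nat (n := (p * a)%N)) ?leq_addr//=.
apply: (congr1 (op _)).
rewrite -{1}[(p * a)%N]add0n [(p * a + p)%N]addnC big_addn addnK big_mkord.
rewrite (big_pred1 (Ordinal cp)) /= => [|i]; first by rewrite addnC.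
by rewrite addnC mulnC modnMDl modn_small.
Qed.

(** The class split off is [p.-1] for factorials (index [i] stands for the factor [i.+1]), [p./2]
    for products over odd numbers, and [0] for the summation index of [apery_poly]. *)
Lemma big_nat_residueID (T : Type) (idx : T) (op : Monoid.com_law idx) (p c a : nat)
    (F : nat -> T) : (c < p)%N ->
  \big[op/idx]_(0 <= i < p * a) F i =
  op (\big[op/idx]_(0 <= j < a) F (p * j + c)%N)
     (\big[op/idx]_(0 <= i < p * a | (i %% p != c)%N) F i).
Proof. by move=> cp; rewrite (bigID (fun i => i %% p == c)%N) big_nat_residue. Qed.

(* The product of the integers of [1, p * a] that are prime to [p]. *)
Definition prime_to_fact (p a : nat) :=
  (\prod_(0 <= i < p * a | (i %% p != p.-1)%N) i.+1)%N.

Lemma fact_prime_to p a : (0 < p)%N ->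
  ((p * a)`! = p ^ a * a`! * prime_to_fact p a)%N.
Proof.
move=> p0; rewrite fact_prod big_add1 /= (@big_nat_residueID _ _ _ p p.-1) ?prednK//=.
congr muln; rewrite fact_prod big_add1 /=.
rewrite -[X in (p ^ X)%N]subn0 -prod_nat_const_nat -big_split /=.
by apply: eq_bigr => i _; rewrite -addnS prednK// mulnS addnC.
Qed.

Lemma modnS_pred p i : (0 < p)%N -> (i %% p == p.-1)%N = (p %| i.+1)%N.
Proof.
move=> p0; rewrite {2}(divn_eq i p) -addnS dvdn_addr ?dvdn_mull//.
have := ltn_pmod i p0; set r := (i %% p)%N => rp.
apply/eqP/idP => [->|/dvdn_leq]; first by rewrite prednK.
by move=> /(_ isT); lia.
Qed.

Lemma prime_to_fact_coprime p a : prime p -> coprime p (prime_to_fact p a).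
Proof.
move=> pp; rewrite /prime_to_fact; elim/big_ind : _ => [|x y cx cy|i].
- exact: coprimen1.
- by rewrite coprimeMr cx.
- by rewrite modnS_pred ?prime_gt0// -prime_coprime.
Qed.

(** The factors beyond [p * d] are those of [prime_to_fact p b] translated by [p * d], a multiple of
    [p ^ v.+1]. *)
Lemma prime_to_factD p v d b : (p ^ v %| d)%N ->
  prime_to_fact p (d + b) = (prime_to_fact p b * prime_to_fact p d)%N
    %[mod p ^ v.+1].
Proof.
move=> vd; rewrite /prime_to_fact mulnDr (big_cat_nat (n := (p * d)%N)) ?leq_addr//=.
rewrite -{2}[(p * d)%N]add0n [(p * d + p * b)%N]addnC big_addn addnK.
rewrite -modnMmr mulnC -[in RHS]modnMml; congr ((_ * _) %% _)%N.
rewrite (eq_bigl (fun i => i %% p != p.-1)%N); last first.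
  by move=> i; rewrite addnC mulnC modnMDl.
apply: (big_ind2 (fun x y => x = y %[mod p ^ v.+1])) => // [x1 x2 y1 y2 e1 e2|i _].
  by rewrite -modnMm e1 e2 modnMm.
have [t ->] := dvdnP vd.
by rewrite mulnCA -expnS -addSn -modnDmr modnMl addn0.
Qed.

(** By [fact_prime_to], the multiples of [p] in the factorials yield the small binomial coefficient
    and powers of [p] that cancel; [u] is the quotient of the parts prime to [p]. *)
Lemma bin_mul_prime p v d b : prime p -> (p ^ v %| d)%N ->
  exists2 u, congp p v.+1 u%:P 1 &
    'C(p * (d + b), p * b)%:R = 'C(d + b, b)%:R * u :> rat.
Proof.
move=> pp vd; have p0 := prime_gt0 pp.
set F := prime_to_fact p.
have cF a : coprime p (F a) by exact: prime_to_fact_coprime.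
have F0 a : (0 < F a)%N.
  rewrite lt0n; apply: contraTneq (cF a) => ->.
  by rewrite /coprime gcdn0 neq_ltn prime_gt1// orbT.
exists ((F (d + b)%N)%:R / (F b * F d)%:R).
  apply: congp_nat_ratio => //; first by rewrite coprimeMr !cF.
    by rewrite muln_gt0 !F0.
  exact: prime_to_factD.
rewrite mulrA; apply/(canRL (mulfK _)); first by rewrite pnatr_eq0 -lt0n muln_gt0 !F0.
rewrite -!natrM; congr (_%:R).
have h1 : (p * b <= p * (d + b))%N by rewrite leq_mul2l leq_addl orbT.
have := bin_fact h1; rewrite -mulnBr addnK !fact_prime_to// -/F.
rewrite -(bin_fact (leq_addl d b)) addnK expnD => e.
have K : (0 < p ^ d * p ^ b * (d`! * b`!))%N by rewrite !muln_gt0 !expn_gt0 p0 !fact_gt0.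
apply/eqP; rewrite -(eqn_pmul2l K); apply/eqP.
transitivity ('C(p * (d + b), p * b) *
   (p ^ b * b`! * F b * (p ^ d * d`! * F d)))%N; first by ring.
by rewrite e; ring.
Qed.

(** Euler's theorem applies because [p * k - k] is a multiple of [totient (p ^ v.+1)]. *)
Lemma congp_pow_ratio p v q k : prime p -> coprime p q -> (p ^ v %| k)%N ->
  congp p v.+1 ((q ^ k)%:R / (q ^ (p * k))%:R)%:P 1.
Proof.
move=> pp pq /dvdnP[t ->]; have p0 := prime_gt0 pp.
have q0 : (0 < q)%N.
  by case: q pq => //; rewrite /coprime gcdn0 => /eqP p1; rewrite p1 in pp.
apply: congp_nat_ratio => //; first exact: coprimeXr.
  by rewrite expn_gt0 q0.
have -> : (p * (t * p ^ v) = t * p ^ v + totient (p ^ v.+1) * t)%N.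
  rewrite totient_pfactor//= -{1}(prednK p0); ring.
have e1 : (q ^ (totient (p ^ v.+1) * t) = 1 %[mod p ^ v.+1])%N.
  rewrite expnM -modnXm cyclic.Euler_exp_totient ?modnXm ?exp1n//.
  by rewrite coprime_sym coprimeXl.
by rewrite expnD -[in RHS]modnMmr e1 modnMmr muln1.
Qed.

(** This follows from [k * 'C(N, k) = N * 'C(N.-1, k.-1)]; if [k] contains more than [n] factors
    [p], the truncated exponent is 0. *)
Lemma dvdn_bin_pow p n N k : prime p -> (0 < k)%N -> (p ^ n %| N)%N ->
  (p ^ (n - logn p k) %| 'C(N, k))%N.
Proof.
move=> pp k0 nN; have [t pt kE] := pfactor_coprime pp k0.
have [ln|ln] := leqP (logn p k) n; last first.
  by rewrite (eqP (ltnW ln : n - _ == 0)%N) dvd1n.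
have h : (p ^ n %| k * 'C(N, k))%N.
  case: k k0 {kE ln} => // k _; rewrite -mul_bin_diag.
  exact: dvdn_mulr.
move: h; rewrite {1}kE -{1}(subnK ln) expnD mulnAC dvdn_pmul2r ?expn_gt0 ?prime_gt0//.
by rewrite Gauss_dvdr// coprimeXl.
Qed.

(* The square of the generalized binomial coefficient of [- 1 / 2] and [k]. *)
Definition central_weight k : rat := ('C(k.*2, k) ^ 2)%:R / (16 ^ k)%:R.

Lemma central_weightS k :
  central_weight k.+1 = central_weight k * (k.*2.+1%:R ^+ 2 / k.*2.+2%:R ^+ 2).
Proof.
have h : ('C(k.*2.+2, k.+1) * k.+1 = 2 * k.*2.+1 * 'C(k.*2, k))%N.
  have h1 := mul_bin_diag k.*2.+2 k; have h2 := mul_bin_down k.*2.+1 k.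
  rewrite /= in h1 h2; rewrite mulnC -h1 -mulnA h2.
  rewrite (_ : k.*2.+1 - k = k.+1)%N; last lia.
  by rewrite mulnA; congr muln; lia.
have {}h : 'C(k.*2.+2, k.+1)%:R = 2 * k.*2.+1%:R * 'C(k.*2, k)%:R / k.+1%:R :> rat.
  apply: (canRL (mulfK _)); first by rewrite pnatr_eq0.
  by rewrite -!natrM h.
rewrite /central_weight doubleS !natrX h [16%:R ^+ k.+1]exprS.
have -> : k.*2.+2%:R = 2 * k.+1%:R :> rat by rewrite -natrM; congr (_%:R); lia.

by field; rewrite expf_neq0 ?pnatr_eq0// -[1]/(1%:R) -natrD pnatr_eq0.
Qed.

(** * The polynomials b_N and their congruences *)

(** For [c = 1] and X = z^2, multiplying by [central_weight k] gives the product over h < k of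
    ((2h+1)^2 - 4 z^2) / (2h+2)^2. *)
Definition hahn_factor (c : rat) k : {poly rat} :=
  \prod_(0 <= i < k) (1 - (4 * c / i.*2.+1%:R ^+ 2) *: 'X).

Lemma p_integral_pow_div p n d : prime p -> (0 < d < p ^ n.+1)%N ->
  p%:R ^+ n / d%:R \in p_integral p.
Proof.
move=> pp /andP[d0 dp]; have [t pt dE] := pfactor_coprime pp d0.
have ln : (logn p d <= n)%N.
  rewrite -ltnS -(ltn_exp2l _ _ (prime_gt1 pp)); apply: leq_ltn_trans dp.
  by apply: dvdn_leq => //; exact: pfactor_dvdnn.
rewrite {1}dE natrM natrX -[in p%:R ^+ n](subnK ln) exprD.
have p0 : p%:R != 0 :> rat by rewrite pnatr_eq0 -lt0n prime_gt0.
rewrite invfM mulrA -mulrA [t%:R^-1 * _]mulrC mulrA mulfK ?expf_neq0//.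
by rewrite rpredM ?p_integral_natV// rpredX// rpred_nat.
Qed.

(** Each odd number 2i + 1 < 2k is below [p ^ n.+1], so it contains at most [n] factors [p], and its
    square divides p^(2n) up to a unit at [p]. *)
Lemma hahn_factor_polyOver p n k : prime p -> (k.*2 <= p ^ n.+1)%N ->
  hahn_factor (p%:R ^+ n.*2) k \is a polyOver (p_integral p).
Proof.
move=> pp kp; rewrite /hahn_factor big_nat; apply: rpred_prod => i /= ik.
rewrite rpredB ?rpred1// polyOverZ ?polyOverX//.
rewrite -mulrA rpredM ?rpred_nat// -mul2n mulnC exprM -expr_div_n rpredX//.
by apply: p_integral_pow_div => //=; apply: leq_trans kp; lia.
Qed.

(** The odd number 2i + 1 is a multiple of [p] exactly for i = p i' + (p-1)/2, where it equals p
    (2i' + 1) and gives the factor of index i' for [n]. At the other indices 2i + 1 is a unit and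
    the factor is 1 modulo p^(2n+2). *)
Lemma hahn_factor_prime p n k : prime p -> odd p ->
  exists2 h, congp p n.+1 h 1 &
  hahn_factor (p%:R ^+ n.+1.*2) (p * k) = hahn_factor (p%:R ^+ n.*2) k * h.
Proof.
move=> pp po; have p0 := prime_gt0 pp.
have cp : (p./2 < p)%N by lia.
have p1 : p%:R != 0 :> rat by rewrite pnatr_eq0 -lt0n.
exists (\prod_(0 <= i < p * k | (i %% p != p./2)%N)
          (1 - (4 * p%:R ^+ n.+1.*2 / i.*2.+1%:R ^+ 2) *: 'X)).
  apply: congp_prod1 => i ip.
  (* If 2i + 1 = q p with i = d p + r, the bounds on r force q = 2d + 1, hence 2r + 1 = p, the
     excluded residue. *)
  have ci : coprime p i.*2.+1.
    rewrite prime_coprime//; apply: contra ip => /dvdnP[q qE].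
    apply/eqP; have := divn_eq i p; have := ltn_pmod i p0; move: qE.
    set d := (i %/ p)%N; set r := (i %% p)%N => qE rp iE.
    have q1 : q = d.*2.+1.
      apply/eqP; rewrite eqn_leq; apply/andP; split; rewrite leqNgt; apply/negP => h.
        have : (d.*2.+2 * p <= q * p)%N by rewrite leq_mul2r h orbT.
        by lia.
      have : (q * p <= d.*2 * p)%N by rewrite leq_mul2r -ltnS h orbT.
      by lia.
    by move: qE; rewrite q1; lia.
  exists (- (4 * p%:R ^+ n.+1 / i.*2.+1%:R ^+ 2) *: 'X).
    rewrite polyOverZ ?polyOverX// rpredN -exprVn rpredM ?rpredX ?p_integral_natV//.
    by rewrite rpredM ?rpredX ?rpred_nat.
  rewrite addrAC subrr add0r scalerA -scaleNr; congr (_ *: _).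
  rewrite mulrN; congr (- _); rewrite -addnn exprD.
  by rewrite !mulrA [_ * 4]mulrC.
rewrite /hahn_factor (@big_nat_residueID _ _ _ p p./2)//=; congr (_ * _).
apply: eq_bigr => i _; congr (1 - _ *: _).
have -> : (p * i + p./2).*2.+1 = (p * i.*2.+1)%N by lia.
by rewrite doubleS 2!exprS natrM; field; rewrite p1 -[1]/(1%:R) -natrD pnatr_eq0.
Qed.

(* In the variable [z ^ 2]; [c = 1] gives b_N, and [c] rescales the variable. *)
Definition apery_poly (c : rat) N : {poly rat} :=
  \sum_(0 <= k < N.+1)
    ((-1) ^+ k * 'C(N, k)%:R * central_weight k) *: hahn_factor c k.

(** The range can thus end at a multiple of [p], as the splitting into residue classes requires. *)
Lemma apery_poly_widen c N M : (N < M)%N -> apery_poly c N =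
  \sum_(0 <= k < M)
    ((-1) ^+ k * 'C(N, k)%:R * central_weight k) *: hahn_factor c k.
Proof.
move=> NM; rewrite [RHS](big_cat_nat (n := N.+1))//= [X in _ + X]big1_seq ?addr0//.
move=> k /=; rewrite mem_index_iota => /andP[Nk _].
by rewrite bin_small// mulr0 mul0r scale0r.
Qed.

Lemma central_weight_polyOver p k : coprime p 2 ->
  (central_weight k)%:P \is a polyOver (p_integral p).
Proof.
move=> p2; rewrite polyOverC rpredM ?rpred_nat ?p_integral_natV//.
by rewrite coprimeXr// -[16%N]/(2 ^ 4)%N coprimeXr.
Qed.

(** With e the minimum of n and the valuation of k, the binomial coefficient ['C(m * p ^ n, k)] is
    divisible by p^(n-e), while every correction factor between the two terms is 1 modulo p^(e+1).
    The two exponents add up to n + 1. *)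
Lemma apery_term_prime p m n k : prime p -> odd p -> (0 < m)%N -> (m.*2 < p)%N ->
  (k <= m * p ^ n)%N ->
  congp p n.+1
    (((-1) ^+ (p * k) * 'C(m * p ^ n.+1, p * k)%:R * central_weight (p * k)) *:
       hahn_factor (p%:R ^+ n.+1.*2) (p * k))
    (((-1) ^+ k * 'C(m * p ^ n, k)%:R * central_weight k) *:
       hahn_factor (p%:R ^+ n.*2) k).
Proof.
move=> pp po m0 mp kN; have p0 := prime_gt0 pp.
have p2 : coprime p 2 by rewrite coprime_sym prime_coprime// dvdn2 po.
set N := (m * p ^ n)%N in kN *.
have [k0|k0] := posnP k.
  rewrite k0 muln0 !bin0 /central_weight /hahn_factor !big_geq//; exact: congp_refl.
pose e := minn (logn p k) n.
have ek : (p ^ e %| k)%N.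
  by apply: dvdn_trans (pfactor_dvdnn p k); rewrite dvdn_exp2l// geq_minl.
have eN : (p ^ e %| N - k)%N.
  by rewrite dvdn_sub// dvdn_mull// dvdn_exp2l// geq_minr.
have [u u1 uE] := bin_mul_prime k pp eN.
have [v v1 vE] := bin_mul_prime k pp ek.
have p16 : coprime p 16 by rewrite -[16%N]/(2 ^ 4)%N coprimeXr.
have w1 := congp_pow_ratio pp p16 ek.
have [h h1 hE] := @hahn_factor_prime p n k pp po.
have [t tE] : exists t, 'C(N, k) = (p ^ (n - e) * t)%N.
  have /dvdnP[t ->] := dvdn_bin_pow pp k0 (dvdn_mull m (dvdnn (p ^ n))).
  exists t; rewrite mulnC; congr (p ^ _ * _)%N; rewrite /e; lia.
have -> : (m * p ^ n.+1 = p * (N - k + k))%N by rewrite subnK// expnS /N; ring.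
rewrite uE subnK// hE.
have cw : central_weight (p * k) = central_weight k *
    (v ^+ 2 * ((16 ^ k)%:R / (16 ^ (p * k))%:R)).
  rewrite /central_weight -muln2 -mulnA muln2 -addnn !natrX vE addnn.
  by field; rewrite !expf_neq0.
(* The signs agree because [p] is odd. *)
rewrite cw -signr_odd oddM po signr_odd.
set w := _ / _ in w1 cw *; clearbody w.
set a := (-1) ^+ k; set b := central_weight k; set H := hahn_factor _ k.
pose A := (t%:R * (a * b))%:P * H.
have pA : A \is a polyOver (p_integral p).
  rewrite rpredM ?hahn_factor_polyOver//.
    rewrite polyOverC 2?rpredM ?rpred_nat// ?rpredX ?rpredN ?rpred1//.
    by rewrite -polyOverC central_weight_polyOver.
  (* The bound on [m] enters here: 2k <= 2m p^n <= p^(n+1). *)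
  rewrite expnS; apply: leq_trans (_ : m.*2 * p ^ n <= _)%N; last first.
    by rewrite leq_mul2r ltnW ?orbT.
  by rewrite -doubleMl leq_double.
have -> : (a * ('C(N, k)%:R * u) * (b * (v ^+ 2 * w))) *: (H * h) =
    (p%:R ^+ (n - e) *: A) * ((u * v ^+ 2 * w)%:P * h).
  rewrite tE natrM natrX /A -!mul_polyC !polyCM; ring.
have -> : (a * 'C(N, k)%:R * b) *: H = (p%:R ^+ (n - e) *: A) * 1.
  rewrite tE natrM natrX /A -!mul_polyC !polyCM; ring.
have -> : n.+1 = (n - e + e.+1)%N by rewrite /e; lia.
apply: congpMl => //.
have i1 f : congp p e.+1 f 1 -> f \is a polyOver (p_integral p).
  by apply: congp_polyOver; exact: rpred1.
have m1 f g : congp p e.+1 f 1 -> congp p e.+1 g 1 -> congp p e.+1 (f * g) 1.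
  by move=> f1 g1; rewrite -[1]mulr1; apply: congpM => //; [exact: i1|exact: rpred1].
rewrite expr2 !polyCM.
have h1' : congp p e.+1 h 1 by apply: congpW h1; rewrite ltnS geq_minr.
exact: (m1 _ _ (m1 _ _ (m1 _ _ u1 (m1 _ _ v1 v1)) w1) h1').
Qed.

(** Multiples of [p] are matched term by term; for k prime to [p], the coefficient
    ['C(m * p ^ n.+1, k)] is already divisible by p^(n+1). *)
Lemma apery_poly_prime p m n : prime p -> odd p -> (0 < m)%N -> (m.*2 < p)%N ->
  congp p n.+1 (apery_poly (p%:R ^+ n.+1.*2) (m * p ^ n.+1))
               (apery_poly (p%:R ^+ n.*2) (m * p ^ n)).
Proof.
move=> pp po m0 mp; have p0 := prime_gt0 pp.
have p2 : coprime p 2 by rewrite coprime_sym prime_coprime// dvdn2 po.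
set N := (m * p ^ n)%N.
have NE : (m * p ^ n.+1 = p * N)%N by rewrite expnS mulnCA.
rewrite (@apery_poly_widen _ _ (p * N.+1)); last by rewrite NE mulnS; lia.
rewrite (@big_nat_residueID _ _ _ p 0)//= -[apery_poly _ N]addr0.
apply: congpD.
  rewrite /apery_poly !big_nat; apply: congp_sum => k /=; rewrite ltnS => kN.
  rewrite addn0; exact: apery_term_prime.
rewrite big_nat_cond; apply: (big_ind (fun f => congp p n.+1 f 0)).
- exact: congp_refl.
- by move=> f g f0 g0; rewrite -[0]addr0; exact: congpD.
move=> k /andP[/= kN pk].
have k0 : (0 < k)%N by case: k pk {kN} => //; rewrite mod0n.
have /dvdnP[t tE] : (p ^ n.+1 %| 'C(m * p ^ n.+1, k))%N.
  have := dvdn_bin_pow pp k0 (dvdn_mull m (dvdnn (p ^ n.+1))).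
  suff -> : logn p k = 0%N by rewrite subn0.
  by apply/eqP; rewrite -leqn0 leqNgt logn_gt0 mem_primes pp k0 /= /dvdn.
(* Indices beyond p N come only from the widened range; below, [hahn_factor_polyOver] applies. *)
have [kN'|kN'] := leqP k (p * N)%N; last first.
  rewrite bin_small ?NE// mulr0 mul0r scale0r; exact: congp_refl.
exists (t%:R%:P * (((-1) ^+ k)%:P * (central_weight k)%:P * hahn_factor (p%:R ^+ n.+1.*2) k)).
  rewrite !rpredM ?polyOverC_nat ?central_weight_polyOver ?hahn_factor_polyOver//.
    by rewrite polyOverC rpredX// rpredN rpred1.
  apply: (@leq_trans (p * N).*2); first by rewrite leq_double.
  by rewrite -NE doubleMl [leqRHS]expnS leq_mul2r ltnW ?orbT.
by rewrite subr0 tE natrM natrX -!mul_polyC !polyCM; ring.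
Qed.

(** * Telescoping *)

Section telescoping.
Variables (S : comNzRingType) (y : S) (g : nat -> S).
(** So [g i] stands for 1 / (2i + 1 - y); the section is later applied to power series in y. *)
Hypothesis gK : forall i, g i * (i.*2.+1%:R - y) = 1.

Lemma prod_shiftl (F : nat -> S) l n :
  \prod_(j < n.+1) F (l + j)%N = F l * \prod_(j < n) F (l.+1 + j)%N.
Proof.
rewrite big_ord_recl addn0; congr (_ * _); apply: eq_bigr => j _.
by rewrite lift0 addnS addSn.
Qed.

Lemma prod_shiftr (F : nat -> S) l n :
  \prod_(j < n.+1) F (l + j)%N = (\prod_(j < n) F (l + j)%N) * F (l + n)%N.
Proof. by rewrite big_ord_recr. Qed.

Lemma inv_node_diff i d : g i - g (i + d) = d.*2%:R * g i * g (i + d).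
Proof.
transitivity (g i * (g (i + d) * ((i + d).*2.+1%:R - y)) -
              g (i + d) * (g i * (i.*2.+1%:R - y))); first by rewrite !gK !mulr1.
have -> : (i + d).*2.+1%:R = d.*2%:R + i.*2.+1%:R :> S.
  by rewrite -natrD; congr (_%:R); lia.
ring.
Qed.

(** This is the partial fraction expansion of the product on the right. By Pascal's rule, the sum
    for n + 1 at l is the difference of the sums for n at l and l + 1. *)
Lemma inv_node_sum n l :
  \sum_(j < n.+1) (-1) ^+ j * 'C(n, j)%:R * g (l + j) =
  (n`! * 2 ^ n)%:R * \prod_(j < n.+1) g (l + j).
Proof.
elim: n l => [|n IH] l.
  by rewrite !big_ord1 expr0 bin0 !mul1r.
transitivity ((\sum_(j < n.+1) (-1) ^+ j * 'C(n, j)%:R * g (l + j)) -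
              \sum_(j < n.+1) (-1) ^+ j * 'C(n, j)%:R * g (l.+1 + j)).
  rewrite big_ord_recl /= bin0.
  under eq_bigr do rewrite /bump /= add1n binS natrD mulrDr mulrDl.
  rewrite big_split /= addrA; congr (_ + _); last first.
    rewrite -sumrN; apply: eq_bigr => j _.
    by rewrite exprS addnS addSn; ring.
  transitivity (\sum_(j < n.+2) (-1) ^+ j * 'C(n, j)%:R * g (l + j)).
    by rewrite [RHS]big_ord_recl /= bin0.
  by rewrite big_ord_recr /= bin_small// mulr0 mul0r addr0.
rewrite !IH [in LHS]prod_shiftl prod_shiftr [in RHS]prod_shiftl prod_shiftr.
set P := \prod_(i < n) _.
transitivity ((n`! * 2 ^ n)%:R * P * (g l - g (l + n.+1))).
  by rewrite addnS addSn; ring.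
rewrite addSnnS inv_node_diff factS expnS.
have -> : (n.+1 * n`! * (2 * 2 ^ n) = n`! * 2 ^ n * n.+1.*2)%N by lia.
by rewrite [in RHS]natrM; ring.
Qed.

(** The Pochhammer symbol 2^n (l+1)_n, with doubled factors to match the spacing of the nodes. *)
Definition rising2 l n : S := \prod_(j < n) (l.+1 + j).*2%:R.

(** The nodes l + j and l + 2k - j have mean l + k, so that 2 a b = c (a + b) for the corresponding
    inverses. This linearizes the sum, which is symmetric under j -> 2k - j, and [inv_node_sum]
    applies. *)
Lemma inv_node_conv k l :
  2 * \sum_(j < k.*2.+1) (-1) ^+ j * 'C(k.*2, j)%:R * (g (l + (k.*2 - j)) * g (l + j)) =
  2 * ((k.*2`! * 2 ^ k.*2)%:R * g (l + k) * \prod_(j < k.*2.+1) g (l + j)).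
Proof.
pose D := \sum_(j < k.*2.+1) (-1) ^+ j * 'C(k.*2, j)%:R * g (l + j).
have Drev : \sum_(j < k.*2.+1) (-1) ^+ j * 'C(k.*2, j)%:R * g (l + (k.*2 - j)) = D.
  rewrite /D (reindex_inj rev_ord_inj) /=; apply: eq_bigr => j _.
  have jk : (j <= k.*2)%N by rewrite -ltnS.
  rewrite subSS bin_sub// subKn//; congr (_ * _ * _).
  by rewrite -signr_odd oddB// odd_double /= signr_odd.
transitivity (g (l + k) * (D + D)); last first.
  by rewrite (inv_node_sum k.*2 l : D = _); ring.
rewrite -{1}Drev mulrDr /D !mulr_sumr -big_split /=; apply: eq_bigr => j _.
have jk : (j <= k.*2)%N by rewrite -ltnS.
set a := g (l + _); set b := g (l + j); set c := g (l + k).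
suff e : 2 * (a * b) = c * a + c * b.
  transitivity ((-1) ^+ j * 'C(k.*2, j)%:R * (2 * (a * b))); first by ring.
  by rewrite e; ring.
have nodes : 2 * ((l + k).*2.+1%:R - y) =
    ((l + (k.*2 - j)).*2.+1%:R - y) + ((l + j).*2.+1%:R - y).
  transitivity ((2 * (l + k).*2.+1)%:R - y - y); first by rewrite natrM; ring.
  rewrite (_ : 2 * (l + k).*2.+1 = (l + (k.*2 - j)).*2.+1 + (l + j).*2.+1)%N; last by lia.
  by rewrite natrD; ring.
transitivity (c * a * b * (2 * ((l + k).*2.+1%:R - y))).
  transitivity (2 * (a * b) * (c * ((l + k).*2.+1%:R - y))); last by ring.
  by rewrite gK mulr1.
rewrite nodes.
transitivity (c * b * (a * ((l + (k.*2 - j)).*2.+1%:R - y)) +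
              c * a * (b * ((l + j).*2.+1%:R - y))); first by ring.
by rewrite /a /b !gK; ring.
Qed.

(** This is t_k(l): the coefficient of y^m collects the integrals of the l-th layer in dimension m +
    2, see [hahn_term_coef]. *)
Definition hahn_term k l : S :=
  rising2 l k.*2 * g (l + k) * \prod_(j < k.*2.+1) g (l + j).

Lemma bin_rising2 k l :
  ('C(k.*2 + l, k.*2) * (k.*2`! * 2 ^ k.*2))%:R = rising2 l k.*2.
Proof.
rewrite /rising2 -natr_prod mulnA bin_ffact ffact_prod; congr (_%:R).
have -> : (2 ^ k.*2 = \prod_(j < k.*2) 2)%N by rewrite prod_nat_const card_ord.
rewrite -big_split /=.
rewrite (reindex_inj rev_ord_inj) /=; apply: eq_bigr => j _.
by have := ltn_ord j; lia.
Qed.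

(** The left side expands (X - Y)^(2k) (X Y)^l into monomials X^a Y^b, each replaced by [g a * g b],
    the generating function of its integrals. *)
Lemma hahn_termE k l :
  2 * ('C(k.*2 + l, k.*2)%:R * \sum_(j < k.*2.+1)
    (-1) ^+ j * 'C(k.*2, j)%:R * (g (l + (k.*2 - j)) * g (l + j))) =
  2 * hahn_term k l.
Proof. by rewrite mulrCA inv_node_conv /hahn_term -bin_rising2 !natrM; ring. Qed.

(* Gosper certificate: the quadratic factor is what the ansatz
   [(a * l + b) * ratio of rising products] is forced to in [hahn_term_telescope]. *)
Definition hahn_cert k l : S :=
  rising2 l k.*2.+1 * \prod_(j < k.*2.+2) g (l + j) *
  (y ^+ 2 - (l + k).+1.*2%:R * y - (k.*2.+1 * (4 * k).+3)%:R).

(** Multiplying by X Y Z turns a polynomial identity in the denominators a, b, c into one between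
    their inverses. *)
Lemma clear_inverses (X Y Z a b c al be ga de : S) :
  X * a = 1 -> Y * b = 1 -> Z * c = 1 ->
  al - be * (a * b) = ga * (a * c) - de * (b * c) ->
  al * (X * Y * Z) - be * Z = ga * Y - de * X.
Proof.
move=> Xa Yb Zc e; transitivity ((al - be * (a * b)) * (X * Y * Z)).
  transitivity (al * (X * Y * Z) - be * Z * (X * a) * (Y * b)); last by ring.
  by rewrite Xa Yb !mulr1.
transitivity (ga * Y * (X * a) * (Z * c) - de * X * (Y * b) * (Z * c)).
  by rewrite e; ring.
by rewrite Xa Yb Zc !mulr1.
Qed.

Lemma hahn_term_telescope k l :
  (2 * k.*2.+1)%:R * (k.*2.+2%:R ^+ 2 * hahn_term k.+1 l
     - (k.*2.+1%:R ^+ 2 - y ^+ 2) * hahn_term k l.+1) =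
  hahn_cert k l.+1 - hahn_cert k l.
Proof.
rewrite /hahn_cert /hahn_term /rising2 doubleS.
pose F i : S := i.*2%:R.
rewrite -/(F _).
rewrite (prod_shiftl F l.+1 k.*2.+1) (prod_shiftl F l.+1 k.*2) !(prod_shiftr F l.+2 k.*2).
rewrite (prod_shiftl g l k.*2.+2) (prod_shiftl g l k.*2.+1) !(prod_shiftr g l.+1 k.*2.+1).
(* All four terms share P and Q; what is left involves only the end nodes X, Y and the central node
   Z. *)
set P := \prod_(i < k.*2) _; set Q := \prod_(i < k.*2.+1) _.
rewrite (addSnnS l k); set X := g l; set Y := g (l.+1 + k.*2.+1)%N; set Z := g (l + k.+1)%N.
have Xa : X * (l.*2.+1%:R - y) = 1 by exact: gK.
have Yb : Y * ((l.+1 + k.*2.+1).*2.+1%:R - y) = 1 by exact: gK.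
have Zc : Z * ((l + k.+1).*2.+1%:R - y) = 1 by exact: gK.
pose al := (2 * k.*2.+1)%:R * k.*2.+2%:R ^+ 2 * F l.+1 * F (l.+2 + k.*2)%N.
pose be := (2 * k.*2.+1)%:R * (k.*2.+1%:R ^+ 2 - y ^+ 2).
pose ga := F (l.+2 + k.*2)%N *
  (y ^+ 2 - F (l + k.+1).+1 * y - (k.*2.+1 * (4 * k).+3)%:R).
pose de := F l.+1 * (y ^+ 2 - (l + k).+1.*2%:R * y - (k.*2.+1 * (4 * k).+3)%:R).
transitivity (P * Q * (al * (X * Y * Z) - be * Z)); first by rewrite /al /be; ring.
rewrite (@clear_inverses X Y Z _ _ _ al be ga de Xa Yb Zc); last first.
  by rewrite /al /be /ga /de /F -!mul2n; ring.
by rewrite /ga /de; ring.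
Qed.

(** The telescoped relation takes [hahn_term k] at [l.+1]; the missing term of index 0 is supplied
    by the certificate at 0. *)
Lemma hahn_cert0 k :
  - ((2 * k.*2.+1)%:R * ((k.*2.+1%:R ^+ 2 - y ^+ 2) * hahn_term k 0)) =
  hahn_cert k 0.
Proof.
rewrite /hahn_cert /hahn_term /rising2 (prod_shiftr (fun i => i.*2%:R) 1) /=.
rewrite (prod_shiftr g 0 k.*2.+1) !add0n.
set P := \prod_(i < k.*2) _; set Q := \prod_(i < k.*2.+1) _.
transitivity (- (P * Q * (1 + k.*2).*2%:R * (k.*2.+1%:R + y) * (g k * (k.*2.+1%:R - y)))).
  by rewrite -!mul2n; ring.
transitivity (- (P * Q * (1 + k.*2).*2%:R * (k.*2.+1%:R + y) *
   (g k.*2.+1 * (k.*2.+1.*2.+1%:R - y)))); first by rewrite !gK.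
by rewrite -!mul2n; ring.
Qed.

Lemma hahn_term_sum k N :
  (2 * k.*2.+1)%:R * (k.*2.+2%:R ^+ 2 * (\sum_(0 <= l < N) hahn_term k.+1 l)
     - (k.*2.+1%:R ^+ 2 - y ^+ 2) * (\sum_(0 <= l < N.+1) hahn_term k l)) =
  hahn_cert k N.
Proof.
elim: N => [|N IH].
  by rewrite big_geq// big_nat1 -hahn_cert0; ring.
rewrite big_nat_recr// [\sum_(0 <= l < N.+2) _]big_nat_recr//=.
rewrite -[RHS](subrK (hahn_cert k N)) -hahn_term_telescope -IH; ring.
Qed.
End telescoping.

(** * Formal power series *)

Definition fps (R : Type) := nat -> R.

Section fps_ring.
Variable R : comNzRingType.
Implicit Types f g h : fps R.

HB.instance Definition _ := gen_eqMixin (fps R).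
HB.instance Definition _ := gen_choiceMixin (fps R).

Definition fps_zero : fps R := fun=> 0.
Definition fps_opp f : fps R := fun n => - f n.
Definition fps_add f g : fps R := fun n => f n + g n.

Fact fps_addA : associative fps_add.
Proof. by move=> f g h; apply/funext => n; exact: addrA. Qed.
Fact fps_addC : commutative fps_add.
Proof. by move=> f g; apply/funext => n; exact: addrC. Qed.
Fact fps_add0 : left_id fps_zero fps_add.
Proof. by move=> f; apply/funext => n; exact: add0r. Qed.
Fact fps_addN : left_inverse fps_zero fps_opp fps_add.
Proof. by move=> f; apply/funext => n; exact: addNr. Qed.

HB.instance Definition _ :=
  GRing.isZmodule.Build (fps R) fps_addA fps_addC fps_add0 fps_addN.

Definition fps_one : fps R := fun n => (n == 0%N)%:R.
Definition fps_mul f g : fps R := fun n => \sum_(i < n.+1) f i * g (n - i)%N.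

(** Coefficients of a product up to degree [n] depend only on truncations, so associativity and
    commutativity are inherited from polynomials. *)
Definition fps_trunc n f : {poly R} := \poly_(i < n.+1) f i.

Lemma fps_mul_trunc n m f g : (m <= n)%N ->
  fps_mul f g m = (fps_trunc n f * fps_trunc n g)`_m.
Proof.
move=> mn; rewrite coefM; apply: eq_bigr => i _.
have im : (i <= m)%N by rewrite -ltnS.
rewrite !coef_poly !ifT// ltnS; first exact: leq_trans (leq_subr _ _) mn.
exact: leq_trans im mn.
Qed.

Fact fps_mulC : commutative fps_mul.
Proof.
by move=> f g; apply/funext => n; rewrite !(@fps_mul_trunc n n)// mulrC.
Qed.
Fact fps_mulA : associative fps_mul.
Proof.
move=> f g h; apply/funext => n.
transitivity ((fps_trunc n f * (fps_trunc n g * fps_trunc n h))`_n).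
  rewrite coefM; apply: eq_bigr => i _; have im : (i <= n)%N by rewrite -ltnS.
  by rewrite (@fps_mul_trunc n) ?leq_subr// coef_poly ifT.
rewrite mulrA coefM; apply: eq_bigr => i _; have im : (i <= n)%N by rewrite -ltnS.
by rewrite (@fps_mul_trunc n)// coef_poly ifT// ltnS leq_subr.
Qed.
Fact fps_mul1 : left_id fps_one fps_mul.
Proof.
move=> f; apply/funext => n; rewrite /fps_mul big_ord_recl /= subn0 mul1r big1 ?addr0//.
by move=> i _; rewrite /fps_one /= mul0r.
Qed.
Fact fps_mulDl : left_distributive fps_mul fps_add.
Proof.
move=> f g h; apply/funext => n; rewrite /fps_mul /fps_add -big_split /=.
by apply: eq_bigr => i _; rewrite mulrDl.
Qed.
Fact fps_one_neq0 : fps_one != 0.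
Proof. by apply/eqP => /(congr1 (@^~ 0%N)); apply/eqP; exact: oner_neq0. Qed.

HB.instance Definition _ := GRing.Zmodule_isComNzRing.Build (fps R)
  fps_mulA fps_mulC fps_mul1 fps_mulDl fps_one_neq0.

Lemma fpsD f g n : (f + g) n = f n + g n. Proof. by []. Qed.
Lemma fpsN f n : (- f) n = - f n. Proof. by []. Qed.
Lemma fpsM f g n : (f * g) n = \sum_(i < n.+1) f i * g (n - i)%N. Proof. by []. Qed.

Lemma fpsMn f k n : (f *+ k) n = f n *+ k.
Proof. by elim: k => // k IH; rewrite !mulrSr fpsD IH. Qed.

Lemma fps_natM f k n : (k%:R * f) n = k%:R * f n.
Proof. by rewrite !mulr_natl fpsMn. Qed.

Lemma fps_sum I (r : seq I) (P : pred I) (F : I -> fps R) n :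
  (\sum_(i <- r | P i) F i) n = \sum_(i <- r | P i) F i n.
Proof. by elim/big_ind2 : _ => // f a g b <- <-. Qed.

Definition fps_var : fps R := fun n => (n == 1%N)%:R.

Lemma fps_varM f n : (fps_var * f) n = if n is n'.+1 then f n' else 0.
Proof.
rewrite mulrC fpsM; case: n => [|n].
  by rewrite big_ord1 /fps_var mulr0.
rewrite !big_ord_recr /= subnn subSnn mulr0 addr0 mulr1 big1 ?add0r// => i _.
rewrite /fps_var (_ : _ == _ = false) ?mulr0//; apply/eqP.
by have := ltn_ord i; lia.
Qed.

End fps_ring.
Arguments fps_var {R}.

(** * Coefficientwise limits of power series *)

Section fps_cvg.
Variable R : realType.
Local Open Scope classical_set_scope.

Definition cvg_coef (F : nat -> fps R) (f : fps R) :=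
  forall n, F l n @[l --> \oo] --> f n.

Lemma cvg_coef_cst f : cvg_coef (fun=> f) f.
Proof. by move=> n; exact: cvg_cst. Qed.

Lemma cvg_coefD F G f g : cvg_coef F f -> cvg_coef G g ->
  cvg_coef (fun l => F l + G l) (f + g).
Proof. by move=> Ff Gg n; exact: cvgD. Qed.

Lemma cvg_coefM F G f g : cvg_coef F f -> cvg_coef G g ->
  cvg_coef (fun l => F l * G l) (f * g).
Proof. by move=> Ff Gg n; apply: cvg_big => [|i _]; [exact: add_continuous|exact: cvgM]. Qed.

Lemma cvg_coef_prod1 (F : nat -> nat -> fps R) k : (forall i, cvg_coef (F i) 1) ->
  cvg_coef (fun l => \prod_(i < k) F i l) 1.
Proof.
move=> Ff; elim: k => [|k IH].
  rewrite (_ : (fun=> _) = fun=> 1); first exact: cvg_coef_cst.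
  by apply/funext => l; rewrite big_ord0.
have -> : (fun l => \prod_(i < k.+1) F i l) = fun l => (\prod_(i < k) F i l) * F k l.
  by apply/funext => l; rewrite big_ord_recr.
rewrite -[X in cvg_coef _ X]mulr1; exact: (cvg_coefM IH (Ff k)).
Qed.

(* The expansion of [1 / (2 i + 1 - y)] at [y = 0]. *)
Definition inv_node i : fps R := fun n => i.*2.+1%:R ^- n.+1.

Lemma inv_nodeK i : inv_node i * (i.*2.+1%:R - fps_var) = 1.
Proof.
rewrite mulrC mulrBl; apply/funext => n.
rewrite fpsD fpsN fps_natM fps_varM /inv_node.
have i0 : i.*2.+1%:R != 0 :> R by rewrite pnatr_eq0.
case: n => [|n]; first by rewrite subr0 expr1 divff.
by rewrite [_ ^+ n.+2]exprS invfM mulrA divff// mul1r subrr.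
Qed.

Lemma inv_node_cvg j : cvg_coef (fun l => inv_node (l + j)) 0.
Proof.
move=> n; rewrite /inv_node.
have h0 : (fun l : nat => (l + j).*2.+1%:R^-1 : R) @ \oo --> 0.
  apply: (@squeeze_cvgr _ _ _ _ (fun=> 0) (@harmonic R)).
  - near=> l; rewrite invr_ge0 ler0n /= /harmonic lef_pV2 ?posrE//.
    by rewrite ler_nat; lia.
  - exact: cvg_cst.
  - exact: cvg_harmonic.
have -> : (fun l => (l + j).*2.+1%:R ^- n.+1) =
    (fun l => ((l + j).*2.+1%:R^-1 : R) ^+ n * (l + j).*2.+1%:R^-1).
  by apply/funext => l; rewrite -exprSr exprVn.
rewrite (_ : (0 : fps R) n = (0 : R) ^+ n * 0); last by rewrite mulr0.
apply: cvgM => //.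
elim: n => [|n IH]; first by under eq_fun do rewrite expr0; exact: cvg_cst.
by under eq_fun do rewrite exprS; rewrite exprS; exact: cvgM.
Unshelve. all: by end_near. Qed.

(** Each factor 2 (l + j + 1) of the rising product is paired with the inverse node l + j, giving 1
    + (1 + y) [inv_node (l + j)], which tends to 1. One inverse node remains, times the quadratic
    factor. *)
Lemma hahn_cert_cvg k : cvg_coef (hahn_cert fps_var inv_node k) (- fps_var).
Proof.
pose F j l : fps R := (l.+1 + j).*2%:R * inv_node (l + j).
have F1 j : cvg_coef (F j) 1.
  have -> : F j = (fun l => 1 + (1 + fps_var) * inv_node (l + j)).
    apply/funext => l; rewrite -[X in _ = X + _](inv_nodeK (l + j)) /F -!mul2n; ring.
  rewrite -[X in cvg_coef _ X]addr0 -(mulr0 (1 + fps_var)).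
  apply: cvg_coefD; first exact: cvg_coef_cst.
  by apply: cvg_coefM; [exact: cvg_coef_cst|exact: inv_node_cvg].
(* The remainder of the quadratic factor after removing -y times the last node; it is independent of
   l. *)
pose c : fps R := k.*2.+1%:R * fps_var - (k.*2.+1 * (4 * k).+3)%:R.
have -> : hahn_cert fps_var inv_node k = (fun l =>
    (\prod_(j < k.*2.+1) F j l) * (- fps_var + c * inv_node (l + k.*2.+1))).
  apply/funext => l; rewrite /hahn_cert /rising2 /F big_split /=.
  rewrite [\prod_(j < k.*2.+2) _]big_ord_recr /= -!mulrA; congr (_ * (_ * _)).
  set G := inv_node _.
  transitivity (- fps_var * (G * ((l + k.*2.+1).*2.+1%:R - fps_var)) + c * G).
    by rewrite /c -!mul2n; ring.
  by rewrite inv_nodeK mulr1.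
rewrite -[X in cvg_coef _ X]mul1r; apply: cvg_coefM.
  exact: (cvg_coef_prod1 _ F1).
rewrite -[X in cvg_coef _ X]addr0 -(mulr0 c).
apply: cvg_coefD; first exact: cvg_coef_cst.
by apply: cvg_coefM; [exact: cvg_coef_cst|exact: inv_node_cvg].
Qed.

(** This is the coefficient of y^n in the limit of [hahn_term_sum]. The limit -y of the certificate
    contributes only for n = 1, and multiplication by y^2 shifts the index by two. *)
Lemma hahn_sum_rec (I : nat -> nat -> R) :
  (forall k n, \sum_(0 <= l < N) hahn_term inv_node k l n @[N --> \oo] --> I k n) ->
  forall k n, n != 1%N -> k.*2.+2%:R ^+ 2 * I k.+1 n =
    k.*2.+1%:R ^+ 2 * I k n - (if n is n'.+2 then I k n' else 0).
Proof.
move=> hI k n n1.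
pose u : R := (2 * k.*2.+1)%:R.
pose A (j : nat) := \sum_(0 <= l < j) hahn_term inv_node k l n.
pose B (j : nat) := \sum_(0 <= l < j) hahn_term inv_node k.+1 l n.
pose C (j : nat) := if n is n'.+2 then \sum_(0 <= l < j) hahn_term inv_node k l n' else 0.
pose c := if n is n'.+2 then I k n' else 0.
have hC : C j @[j --> \oo] --> c.
  by rewrite /C /c; case: n {n1 A B C c} => [|[|n]]; [exact: cvg_cst|exact: cvg_cst|exact: hI].
have lhs : u * (k.*2.+2%:R ^+ 2 * B j - (k.*2.+1%:R ^+ 2 * A j.+1 - C j.+1))
   @[j --> \oo] --> u * (k.*2.+2%:R ^+ 2 * I k.+1 n - (k.*2.+1%:R ^+ 2 * I k n - c)).
  apply: cvgM; first exact: cvg_cst.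
  apply: cvgB; first by apply: cvgM; [exact: cvg_cst|exact: hI].
  apply: cvgB; last by rewrite (cvg_shiftS C).
  by apply: cvgM; [exact: cvg_cst|rewrite (cvg_shiftS A); exact: hI].
have rhs := hahn_cert_cvg k (n := n).
have y0 : (- fps_var : fps R) n = 0 by rewrite fpsN /fps_var (negbTE n1) oppr0.
rewrite y0 in rhs.
have key j : u * (k.*2.+2%:R ^+ 2 * B j - (k.*2.+1%:R ^+ 2 * A j.+1 - C j.+1)) =
    hahn_cert fps_var inv_node k j n.
  rewrite -(hahn_term_sum inv_nodeK) -!natrX fps_natM fpsD fpsN mulrBl fpsD fpsN.
  rewrite !fps_natM expr2 -mulrA !fps_varM !fps_sum /u /A /B /C !natrX.
  by case: n {n1 A B C c hC lhs rhs y0} => [|[|n]] //; rewrite fps_varM ?fps_sum.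
rewrite (_ : (fun j => _) = (fun j => hahn_cert fps_var inv_node k j n)) in lhs; last first.
  exact/funext.
have := cvg_lim (@Rhausdorff R) lhs; rewrite (cvg_lim (@Rhausdorff R) rhs).
move=> /(_ _)/esym/eqP; rewrite mulf_eq0 pnatr_eq0 /= subr_eq0 => /eqP ->.
by rewrite /c.
Qed.
End fps_cvg.

(** * Integration over the cube *)

Section cube.
Local Open Scope classical_set_scope.
Variable R : realType.
Local Notation RT := (measurableTypeR R).

Lemma integral_expr n :
  (\int[@lebesgue_measure R]_(x in `[0%R, 1%R]) (x ^+ n)%:E = (n.+1%:R^-1)%:E)%E.
Proof.
rewrite (@continuous_FTC2 _ _ (fun x => x ^+ n.+1 / n.+1%:R))//=.
- by rewrite expr1n mul1r expr0n/= mul0r sube0.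
- by apply: continuous_in_subspaceT => x x01; exact: exprn_continuous.
- split.
  + by move=> y y01; apply: derivableM => //=; exact: exprn_derivable.
  + apply: cvgM; last exact: cvg_cst.
    by apply: cvg_at_right_filter; exact: exprn_continuous.
  + apply: cvgM; last exact: cvg_cst.
    by apply: cvg_at_left_filter; exact: exprn_continuous.
- move=> x x01; rewrite derive1Mr//; last exact: exprn_derivable.
  rewrite derive1E exp_derive /GRing.scale /= mulr1.
  by rewrite mulrAC divff ?mul1r ?pnatr_eq0.
Qed.

Lemma measurable_unit_cube k : measurable (unit_cube R k).
Proof.
rewrite (_ : unit_cube R k = \bigcap_(i in [set: 'I_k])
    [set u : k.-tuple RT | (`[0, 1] : set RT) (tnth u i)]); last first.
  by apply/seteqP; split => u /= h i *; exact: h.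
apply: fin_bigcap_measurable => [|i _]; first exact: finite_finset.
rewrite -[X in measurable X]setTI.
by apply: (@measurable_tnth _ RT k i) => //; exact: measurable_itv.
Qed.

Definition monomial k (e : 'I_k -> nat) (u : k.-tuple RT) : R :=
  \prod_(i < k) tnth u i ^+ e i.

Lemma measurable_monomial k e D : measurable_fun D (@monomial k e).
Proof.
apply: measurable_prod => i _; apply: measurable_funX.
by apply: (@measurable_funS _ _ _ _ setT) => //; exact: measurable_tnth.
Qed.

Lemma monomial_ge0 k e u : unit_cube R k u -> 0 <= monomial e u.
Proof.
move=> cu; apply: prodr_ge0 => i _; apply: exprn_ge0.
by have := cu i; rewrite in_itv /= => /andP[].
Qed.

(** Induction on the dimension: Tonelli's theorem peels off the first coordinate. *)
Lemma integral_monomial k e :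
  (\int[lebesgue_tuple R k]_(u in unit_cube R k) (@monomial k e u)%:E =
   (\prod_(i < k) (e i).+1%:R^-1)%:E)%E.
Proof.
elim: k e => [|k IH] e.
  rewrite big_ord0 integral_dirac//=.
  - by rewrite diracE mem_set ?mul1e /monomial ?big_ord0// => -[].
  - exact: measurable_unit_cube.
  - apply/measurable_EFinP; exact: measurable_monomial.
pose e' (i : 'I_k) := e (lift ord0 i).
have cE : @cons_tuple_pair RT k @^-1` unit_cube R k.+1 =
    (`[0%R, 1%R] : set RT) `*` unit_cube R k.
  apply/seteqP; split => -[x t] /=.
    move=> h; split; first by have := h ord0.
    by move=> i; have := h (lift ord0 i); rewrite /cons_tuple_pair tnthS.
  move=> [hx ht] i; case: (unliftP ord0 i) => [j ->|-> //].
  by rewrite /cons_tuple_pair tnthS.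
have mE (x : RT) t : monomial e (cons_tuple_pair (x, t)) = x ^+ e ord0 * monomial e' t.
  rewrite /monomial big_ord_recl; congr (_ * _).
  by apply: eq_bigr => i _; rewrite /cons_tuple_pair tnthS.
rewrite /= ge0_integral_pushforward; first last.
- by move=> u; rewrite inE => cu; rewrite lee_fin monomial_ge0.
- apply/measurable_EFinP; exact: measurable_monomial.
- exact: measurable_unit_cube.
- exact: measurable_cons_tuple_pair.
rewrite cE integral_mkcond.
(* Extending by zero turns the integral over the box into one of a product function over the whole
   space. *)
pose F x : R := (fun x => x ^+ e ord0) \_ (`[0%R, 1%R] : set RT) x.
pose G : k.-tuple RT -> R := monomial e' \_ (unit_cube R k).
have FGE z : ((EFin \o monomial e \o @cons_tuple_pair RT k) \_
    ((`[0%R, 1%R] : set RT) `*` unit_cube R k)) z = (F z.1 * G z.2)%:E.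
  case: z => x t; rewrite /F /G !patchE /= in_setX.
  by case: (x \in _); case: (t \in _); rewrite /= ?mE ?mulr0 ?mul0r.
have F0 x : 0 <= F x.
  rewrite /F patchE; case: ifPn => //; rewrite inE /= in_itv /= => /andP[x0 _].
  exact: exprn_ge0.
have G0 t : 0 <= G t.
  by rewrite /G patchE; case: ifPn => //; rewrite inE => /monomial_ge0.
have mF : measurable_fun [set: RT] F.
  apply/(measurable_restrictT _ (measurable_itv _)).
  exact: exprn_measurable.
have mG : measurable_fun setT G.
  apply: (measurable_restrictT (monomial e') (@measurable_unit_cube k)).1.
  exact: measurable_monomial.
rewrite (eq_integral (fun z => (F z.1 * G z.2)%:E)); last by move=> z _; exact: FGE.
rewrite fubini_tonelli1; first last.
- by move=> z; rewrite lee_fin mulr_ge0.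
- apply/measurable_EFinP; apply: measurable_funM.
    exact: measurableT_comp.
  exact: measurableT_comp.
rewrite /fubini_F /=.
have GI : (\int[lebesgue_tuple R k]_t (G t)%:E = (\prod_(i < k) (e' i).+1%:R^-1)%:E)%E.
  by rewrite -IH [RHS]integral_mkcond; apply: eq_integral => t _; rewrite restrict_EFin.
transitivity (\int[@lebesgue_measure R]_x
    ((\prod_(i < k) (e' i).+1%:R^-1)%:E * (F x)%:E))%E.
  apply: eq_integral => x _; under eq_integral do rewrite EFinM.
  rewrite ge0_integralZl//; first by rewrite GI muleC.
  - exact/measurable_EFinP.
  - by move=> t _; rewrite lee_fin.
  - by rewrite lee_fin.
rewrite ge0_integralZl//; first last.
- by rewrite lee_fin prodr_ge0.
- by move=> x _; rewrite lee_fin.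
- exact/measurable_EFinP.
rewrite big_ord_recl EFinM muleC; congr (_ * _)%E.
rewrite -integral_expr [RHS]integral_mkcond.
by apply: eq_integral => x _; rewrite /F restrict_EFin.
Qed.

End cube.

(** * The negative binomial series *)

Section negative_binomial.
Variable R : realType.
Local Open Scope classical_set_scope.
Variable q : R.
Hypotheses (q0 : 0 <= q) (q1 : q < 1).

(** Pascal's rule on partial sums; the last term is the truncation error. *)
Lemma negbin_rec d N :
  (1 - q) * \sum_(0 <= l < N) 'C(d.+1 + l, d.+1)%:R * q ^+ l =
  \sum_(0 <= l < N) 'C(d + l, d)%:R * q ^+ l - 'C(d + N, d.+1)%:R * q ^+ N.
Proof.
elim: N => [|N IH]; first by rewrite !big_geq// addn0 bin_small// mul0r mulr0 subr0.
rewrite !big_nat_recr//= mulrDr IH addSn addnS binS natrD exprS.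
ring.
Qed.

Lemma negbin_cvg d :
  \sum_(0 <= l < N) 'C(d + l, d)%:R * q ^+ l @[N --> \oo] --> (1 - q) ^- d.+1.
Proof.
have q1' : 0 < 1 - q by rewrite subr_gt0.
elim: d => [|d IH].
  have -> : (fun N => \sum_(0 <= l < N) 'C(0 + l, 0)%:R * q ^+ l) = series (geometric 1 q).
    by apply/funext => N; apply: eq_bigr => l _; rewrite bin0.
  rewrite expr1 -[X in _ --> X]mul1r; apply: cvg_geometric_series.
  by rewrite ger0_norm.
pose a l : R := 'C(d.+1 + l, d.+1)%:R * q ^+ l.
have a0 l : 0 <= a l by rewrite mulr_ge0 ?ler0n ?exprn_ge0.
pose S := series a.
have Snd : nondecreasing_seq S.
  by apply/nondecreasing_seqP => N; rewrite /S /series /= big_nat_recr//= lerDl.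
(* The partial sums increase, and by [negbin_rec] they are at most 1 / (1 - q) times those for d. *)
have cS : cvgn S.
  apply: nondecreasing_is_cvgn => //.
  exists ((1 - q) ^- d.+2) => _ [N _ <-].
  rewrite exprS invfM mulrC ler_pdivlMr// mulrC negbin_rec.
  apply: (@le_trans _ _ (\sum_(0 <= l < N) 'C(d + l, d)%:R * q ^+ l)).
    by rewrite gerBl mulr_ge0 ?ler0n ?exprn_ge0.
  rewrite -(cvg_lim (@Rhausdorff R) IH).
  apply: nondecreasing_cvgn_le; last by apply/cvg_ex; exists ((1 - q) ^- d.+1).
  apply/nondecreasing_seqP => M; rewrite big_nat_recr//= lerDl.
  by rewrite mulr_ge0 ?ler0n ?exprn_ge0.
(* The truncation error is dominated by the general term of the convergent series. *)
have b0 : 'C(d + N, d.+1)%:R * q ^+ N @[N --> \oo] --> (0 : R).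
  apply: (@squeeze_cvgr _ _ _ _ (fun=> 0) a).
  - apply: nearW => N; rewrite mulr_ge0 ?ler0n ?exprn_ge0//= /a ler_wpM2r ?exprn_ge0//.
    by rewrite ler_nat leq_bin2l// addSn.
  - exact: cvg_cst.
  - exact: cvg_series_cvg_0.
have -> : (fun N => \sum_(0 <= l < N) 'C(d.+1 + l, d.+1)%:R * q ^+ l) =
    (fun N => (1 - q)^-1 * (\sum_(0 <= l < N) 'C(d + l, d)%:R * q ^+ l
                - 'C(d + N, d.+1)%:R * q ^+ N)).
  by apply/funext => N; rewrite -negbin_rec mulKf// gt_eqF.
rewrite exprS invfM; apply: cvgM; first exact: cvg_cst.
by rewrite -[X in _ --> X]subr0; exact: cvgB.
Qed.

End negative_binomial.

(** * Integrals of the kernels H_k for fixed dimension and fixed r *)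

Section J_terms.
Local Open Scope classical_set_scope.
Variables (R : realType) (K r : nat).
Hypotheses (r0 : (0 < r)%N) (rK : (r < K)%N).
Local Notation RT := (measurableTypeR R).
Local Notation cube := (unit_cube R K).
Local Notation mu := (lebesgue_tuple R K).

(** These are the X and Y of the overview, and [J_kernel k] is H_k. *)
Definition head_prod (u : K.-tuple RT) : R := \prod_(i < K | (i < r)%N) tnth u i ^+ 2.
Definition tail_prod (u : K.-tuple RT) : R := \prod_(i < K | (r <= i)%N) tnth u i ^+ 2.

Definition J_kernel k (u : K.-tuple RT) : R :=
  (head_prod u - tail_prod u) ^+ k.*2 / (1 - head_prod u * tail_prod u) ^+ k.*2.+1.

Lemma part_prodE u : head_prod u * tail_prod u = \prod_(i < K) tnth u i ^+ 2.
Proof.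
rewrite [RHS](bigID (fun i : 'I_K => (i < r)%N)) /=; congr (_ * _).
by apply: eq_bigl => i; rewrite -leqNgt.
Qed.

(* [(1 - X^2) (1 - Y^2) = (1 - X Y)^2 - (X - Y)^2], expanded by the binomial
   formula. *)
Lemma J_integrand_J_kernel n u :
  J_integrand r n u = \sum_(k < n.+1) (-1) ^+ k * 'C(n, k)%:R * J_kernel k u.
Proof.
have X2 : \prod_(i < K | (i < r)%N) tnth u i ^+ 4 = head_prod u ^+ 2.
  by rewrite /head_prod -prodrXl; apply: eq_bigr => i _; rewrite -exprM.
have Y2 : \prod_(i < K | (r <= i)%N) tnth u i ^+ 4 = tail_prod u ^+ 2.
  by rewrite /tail_prod -prodrXl; apply: eq_bigr => i _; rewrite -exprM.
rewrite /J_integrand X2 Y2 -part_prodE /J_kernel.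
set X := head_prod u; set Y := tail_prod u.
(* Where the denominator vanishes both sides are 0, since the inverse of 0 is 0. *)
have [e|e] := eqVneq (1 - X * Y) 0.
  rewrite e expr0n invr0 mulr0 big1// => k _.
  by rewrite expr0n invr0 !mulr0.
rewrite -exprMn.
have -> : (1 - X ^+ 2) * (1 - Y ^+ 2) = (1 - X * Y) ^+ 2 - (X - Y) ^+ 2 by ring.
rewrite exprBn mulr_suml; apply: eq_bigr => k _.
have kn : (k <= n)%N by rewrite -ltnS.
have -> : (1 - X * Y) ^+ n.*2.+1 = ((1 - X * Y) ^+ 2) ^+ (n - k) * (1 - X * Y) ^+ k.*2.+1.
  by rewrite -exprM -exprD; congr (_ ^+ _); lia.
rewrite -[X in _ = _ * (X / _)](_ : ((X - Y) ^+ 2) ^+ k = _); last first.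
  by rewrite -exprM mul2n.
rewrite -mulr_natr; field.
by rewrite !expf_neq0.
Qed.

(** The l-th term of H_k expanded in powers of X Y. *)
Definition kernel_layer k l u : R :=
  'C(k.*2 + l, k.*2)%:R *
  ((head_prod u - tail_prod u) ^+ k.*2 * (head_prod u * tail_prod u) ^+ l).

Definition layer_coef k l j : R := 'C(k.*2 + l, k.*2)%:R * ((-1) ^+ j * 'C(k.*2, j)%:R).

Definition layer_integral k l : R := \sum_(j < k.*2.+1) layer_coef k l j *
  ((l + (k.*2 - j)).*2.+1%:R ^- r * (l + j).*2.+1%:R ^- (K - r)).

Definition two_block (a b : nat) (i : 'I_K) : nat :=
  if (i < r)%N then a.*2 else b.*2.

Lemma monomial_two_block a b u :
  monomial (two_block a b) u = head_prod u ^+ a * tail_prod u ^+ b.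
Proof.
rewrite /monomial (bigID (fun i : 'I_K => (i < r)%N)) /= /head_prod /tail_prod -!prodrXl.
congr (_ * _); first by apply: eq_bigr => i ir; rewrite /two_block ir -exprM mul2n.
under eq_bigl do rewrite -leqNgt.
by apply: eq_bigr => i ri; rewrite /two_block ltnNge ri -exprM mul2n.
Qed.

Lemma integral_two_block a b :
  (\int[mu]_(u in cube) (monomial (two_block a b) u)%:E =
   (a.*2.+1%:R ^- r * b.*2.+1%:R ^- (K - r))%:E)%E.
Proof.
rewrite integral_monomial; congr (_%:E).
rewrite (bigID (fun i : 'I_K => (i < r)%N)) /=; congr (_ * _).
  rewrite (eq_bigr (fun=> a.*2.+1%:R^-1)); last by move=> i ir; rewrite /two_block ir.
  by rewrite -(big_ord_widen K (fun=> a.*2.+1%:R^-1) (ltnW rK)) prodr_const card_ord exprVn.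
under eq_bigl do rewrite -leqNgt.
rewrite (eq_bigr (fun=> b.*2.+1%:R^-1)); last first.
  by move=> i ri; rewrite /two_block ltnNge ri.
by rewrite -(big_geq_mkord r K (fun=> true) (fun=> b.*2.+1%:R^-1)) prodr_const_nat exprVn.
Qed.

Lemma kernel_layerE k l u : kernel_layer k l u =
  \sum_(j < k.*2.+1) layer_coef k l j *
    monomial (two_block (l + (k.*2 - j)) (l + j)) u.
Proof.
rewrite /kernel_layer exprBn mulr_suml mulr_sumr; apply: eq_bigr => j _.
rewrite monomial_two_block /layer_coef !exprD exprMn -mulr_natr; ring.
Qed.

Lemma integrable_monomial e : mu.-integrable cube (EFin \o @monomial R K e).
Proof.
apply/integrableP; split.
  by apply/measurable_EFinP; exact: measurable_monomial.
rewrite (eq_integral (fun u => (monomial e u)%:E)); last first.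
  by move=> u; rewrite inE => cu; rewrite /= ger0_norm ?monomial_ge0.
by rewrite integral_monomial ltry.
Qed.

Lemma integral_kernel_layer k l :
  (\int[mu]_(u in cube) (kernel_layer k l u)%:E = (layer_integral k l)%:E)%E.
Proof.
pose f (j : 'I_k.*2.+1) u := ((layer_coef k l j)%:E *
  (EFin \o monomial (two_block (l + (k.*2 - j)) (l + j))) u)%E.
rewrite (eq_integral (fun u => \sum_(j < k.*2.+1) f j u)%E); last first.
  by move=> u _; rewrite kernel_layerE -sumEFin; apply: eq_bigr => j _; rewrite EFinM.
rewrite integral_sum//; first last.
- by move=> j; apply: integrableZl; [exact: measurable_unit_cube|exact: integrable_monomial].
- exact: measurable_unit_cube.
rewrite /layer_integral -sumEFin; apply: eq_bigr => j _; rewrite /f integralZl.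
- by rewrite integral_two_block -EFinM.
- exact: measurable_unit_cube.
- exact: integrable_monomial.
Qed.

Lemma measurable_kernel_layer k l D : measurable_fun D (kernel_layer k l).
Proof.
rewrite (_ : kernel_layer k l = fun u => \sum_(j < k.*2.+1) layer_coef k l j *
    monomial (two_block (l + (k.*2 - j)) (l + j)) u); last first.
  by apply/funext => u; exact: kernel_layerE.
apply: measurable_sum => j; apply: measurable_funM; first exact: measurable_cst.
exact: measurable_monomial.
Qed.

Lemma cube_part u : cube u -> [/\ 0 <= head_prod u <= 1 & 0 <= tail_prod u <= 1].
Proof.
move=> cu; have h i : 0 <= tnth u i ^+ 2 <= 1.
  have := cu i; rewrite in_itv /= => /andP[u0 u1].
  by rewrite exprn_ge0// exprn_ile1.
split; apply/andP; split.
- by apply: prodr_ge0 => i _; case/andP: (h i).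
- by apply: prodr_ile1 => i _.
- by apply: prodr_ge0 => i _; case/andP: (h i).
- by apply: prodr_ile1 => i _.
Qed.

Definition ones : set (K.-tuple RT) := [set u | forall i, [set 1%R] (tnth u i)].

Lemma measurable_ones : measurable ones.
Proof.
rewrite (_ : ones = \bigcap_(i in [set: 'I_K]) [set u | [set 1%R] (tnth u i)]); last first.
  by apply/seteqP; split => u /= h i *; exact: h.
apply: fin_bigcap_measurable => [|i _]; first exact: finite_finset.
rewrite -[X in measurable X]setTI.
by apply: (@measurable_tnth _ RT K i) => //; exact: measurable_set1.
Qed.

Lemma ones_null : mu ones = 0%E.
Proof.
rewrite /ones (@lebesgue_tuple_box R K (fun=> [set 1%R])); last first.
  by move=> i; exact: measurable_set1.
rewrite (bigD1 (Ordinal rK)) //= lebesgue_measure_set1 mul0e//.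
Qed.

Lemma XY_ones u : ones u -> head_prod u * tail_prod u = 1.
Proof. by move=> u1; rewrite part_prodE big1// => i _; rewrite u1 expr1n. Qed.

Lemma XY_lt1 u : cube u -> ~ ones u -> head_prod u * tail_prod u < 1.
Proof.
move=> cu /existsNP[i /eqP ui]; rewrite part_prodE (bigD1 i)//=.
have h j : 0 <= tnth u j <= 1 by have := cu j; rewrite in_itv.
have /andP[u0 u1] := h i.
apply: (@le_lt_trans _ _ (tnth u i ^+ 2)).
  apply: ler_piMr; first exact: exprn_ge0.
  by apply: prodr_ile1 => j _; have /andP[? ?] := h j; rewrite exprn_ge0// exprn_ile1.
by rewrite exprn_ilt1// lt_neqAle ui.
Qed.

Lemma kernel_layer_ge0 k l u : cube u -> 0 <= kernel_layer k l u.
Proof.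
move=> /cube_part[/andP[x0 _] /andP[y0 _]].
rewrite mulr_ge0// mulr_ge0//; last by rewrite exprn_ge0// mulr_ge0.
by rewrite -mul2n exprM exprn_ge0// sqr_ge0.
Qed.

Lemma layer_integral_ge0 k l : 0 <= layer_integral k l.
Proof.
rewrite -lee_fin -integral_kernel_layer; apply: integral_ge0 => u cu.
by rewrite lee_fin kernel_layer_ge0.
Qed.

(** Off [ones] one has X Y < 1 and the negative binomial series applies. On [ones] the quotient is 0
    by convention, so cutting the layers there makes the equality hold on the whole cube. *)
Lemma J_kernel_series k u : cube u ->
  ((J_kernel k u)%:E = \sum_(0 <= l <oo) ((kernel_layer k l \_ (~` ones)) u)%:E)%E.
Proof.
move=> cu; apply/esym; have [u1|u1] := pselect (ones u).
  rewrite eseries0; last first.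
    by move=> l _ _; rewrite patchE memNset// => /(_ u1).
  by rewrite /J_kernel XY_ones// subrr expr0n invr0 mulr0.
have [/andP[x0 _] /andP[y0 _]] := cube_part cu.
have q1 := XY_lt1 cu u1; have q0 := mulr_ge0 x0 y0.
apply: cvg_lim => //.
have -> : (fun N => \sum_(0 <= l < N) ((kernel_layer k l \_ (~` ones)) u)%:E)%E =
    EFin \o (fun N => (head_prod u - tail_prod u) ^+ k.*2 *
      \sum_(0 <= l < N) 'C(k.*2 + l, k.*2)%:R * (head_prod u * tail_prod u) ^+ l).
  apply/funext => N; rewrite sumEFin /= mulr_sumr; congr (_%:E).
  by apply: eq_bigr => l _; rewrite patchE mem_set// /kernel_layer mulrCA.
apply: cvg_EFin; first by apply: nearW.
apply: cvgM; first exact: cvg_cst.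
exact: negbin_cvg.
Qed.

Lemma measurable_J_kernel k : measurable_fun cube (J_kernel k).
Proof.
apply/measurable_EFinP.
apply: (eq_measurable_fun (fun u =>
  \sum_(0 <= l <oo) ((kernel_layer k l \_ (~` ones)) u)%:E)%E).
  by move=> u; rewrite inE => /(J_kernel_series k) /esym.
apply: ge0_emeasurable_sum.
- by move=> l u cu _; rewrite patchE lee_fin; case: ifP => // _; exact: kernel_layer_ge0.
- move=> l _; apply/measurable_EFinP; apply: (@measurable_funS _ _ _ _ setT) => //.
  apply: (measurable_restrictT _ (measurableC measurable_ones)).1.
  exact: measurable_kernel_layer.
Qed.

(** The layers are nonnegative, so sum and integral commute; removing the null set [ones] does not
    change the integrals. *)
Lemma integral_J_kernel k :
  (\int[mu]_(u in cube) (J_kernel k u)%:E = \sum_(0 <= l <oo) (layer_integral k l)%:E)%E.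
Proof.
have mc : measurable cube by exact: measurable_unit_cube.
transitivity (\int[mu]_(u in cube)
    \sum_(0 <= l <oo) ((kernel_layer k l \_ (~` ones)) u)%:E)%E.
  by apply: eq_integral => u; rewrite inE => cu; exact: J_kernel_series.
rewrite integral_nneseries//; first last.
- by move=> l u cu; rewrite patchE lee_fin; case: ifP => // _; exact: kernel_layer_ge0.
- move=> l; apply/measurable_EFinP; apply: (@measurable_funS _ _ _ _ setT) => //.
  apply: (measurable_restrictT _ (measurableC measurable_ones)).1.
  exact: measurable_kernel_layer.
apply: eq_eseriesr => l _.
rewrite -integral_kernel_layer [RHS](ge0_negligible_integral measurable_ones)//; first last.
- exact: ones_null.
- by move=> u cu; rewrite lee_fin kernel_layer_ge0.
- by apply/measurable_EFinP; exact: measurable_kernel_layer.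
rewrite setDE integral_mkcondr; apply: eq_integral => u _.
by rewrite restrict_EFin.
Qed.

Lemma layer_integral0 l : layer_integral 0 l = l.*2.+1%:R ^- K.
Proof.
rewrite /layer_integral /layer_coef big_ord1 /= !bin0 expr0 !mul1r !addn0 -invfM -exprD.
by rewrite subnKC// ltnW.
Qed.

(** Comparison with the telescoping series of 1 / ((l+1) (l+2)). *)
Lemma odd_sum_le N : (2 <= K)%N ->
  \sum_(0 <= l < N.+1) l.*2.+1%:R ^- K <= 2 - N.+1%:R^-1 :> R.
Proof.
move=> K2; elim: N => [|N IH]; first by rewrite big_nat1 expr1n invr1; lra.
rewrite big_nat_recr//=; apply: le_trans (lerD IH (lexx _)) _.
suff h : N.+1.*2.+1%:R ^- K <= (N.+1%:R * N.+2%:R)^-1 :> R.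
  apply: le_trans (lerD (lexx _) h) _.
  rewrite (_ : (N.+1%:R * N.+2%:R)^-1 = N.+1%:R^-1 - N.+2%:R^-1 :> R).
    by rewrite addrA subrK.
  have -> : N.+2%:R = 1 + N.+1%:R :> R by rewrite nat1r.
  by field; rewrite !nat1r !pnatr_eq0.
rewrite lef_pV2 ?posrE ?mulr_gt0 ?exprn_gt0 ?ltr0n// -natrM -natrX ler_nat.
apply: (@leq_trans (N.+1.*2.+1 ^ 2)); last by rewrite leq_exp2l.
nia.
Qed.

Lemma layer_integral0_lty : (\sum_(0 <= l <oo) (layer_integral 0 l)%:E < +oo)%E.
Proof.
apply: (@le_lt_trans _ _ 2%:E); last exact: ltry.
apply: lime_le.
  by apply: is_cvg_nneseries => l _ _; rewrite lee_fin layer_integral_ge0.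
apply: nearW => N; rewrite sumEFin lee_fin.
apply: (@le_trans _ _ (\sum_(0 <= l < N.+1) layer_integral 0 l)).
  by rewrite big_nat_recr//= lerDl layer_integral_ge0.
under eq_bigr do rewrite layer_integral0.
by apply: (le_trans (odd_sum_le _ _)); rewrite ?gerBl// (leq_ltn_trans r0).
Qed.

Lemma J_kernel_ge0 k u : cube u -> 0 <= J_kernel k u.
Proof.
move=> cu; rewrite -lee_fin J_kernel_series//; apply: nneseries_ge0 => l _ _.
by rewrite patchE lee_fin; case: ifP => // _; exact: kernel_layer_ge0.
Qed.

(** Since (1 - X Y)^2 - (X - Y)^2 = (1 - X^2) (1 - Y^2) >= 0 on the cube, integrability of every H_k
    reduces to that of H_0. *)
Lemma J_kernel_le k u : cube u -> J_kernel k u <= J_kernel 0 u.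
Proof.
move=> cu; have [/andP[x0 x1] /andP[y0 y1]] := cube_part cu.
rewrite /J_kernel expr0 expr1 mul1r; set X := head_prod u in x0 x1 *.
set Y := tail_prod u in y0 y1 *.
have xy : X * Y <= 1 by rewrite mulr_ile1.
have [e|e] := eqVneq (1 - X * Y) 0; first by rewrite e expr0n invr0 mulr0.
have d0 : 0 < 1 - X * Y by rewrite lt_neqAle eq_sym e subr_ge0.
rewrite exprSr invfM mulrA; apply: ler_piMl; first by rewrite invr_ge0 ltW.
rewrite ler_pdivrMr ?exprn_gt0// mul1r -mul2n !exprM.
apply: lerXn2r; rewrite ?nnegrE ?sqr_ge0//.
rewrite -subr_ge0 (_ : _ - _ = (1 - X ^+ 2) * (1 - Y ^+ 2)); last by ring.
by rewrite mulr_ge0// subr_ge0 exprn_ile1.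
Qed.

Lemma integrable_J_kernel k : mu.-integrable cube (EFin \o J_kernel k).
Proof.
have mc : measurable cube by exact: measurable_unit_cube.
have h0 : mu.-integrable cube (EFin \o J_kernel 0).
  apply/integrableP; split.
    by apply/measurable_EFinP; exact: measurable_J_kernel.
  rewrite (eq_integral (fun u => (J_kernel 0 u)%:E)); last first.
    by move=> u; rewrite inE => cu; rewrite /= ger0_norm ?J_kernel_ge0.
  by rewrite integral_J_kernel layer_integral0_lty.
apply: le_integrable h0 => //.
  by apply/measurable_EFinP; exact: measurable_J_kernel.
move=> u cu; rewrite /= lee_fin !ger0_norm ?J_kernel_ge0//.
exact: J_kernel_le.
Qed.

Lemma integral_J_kernel_fin k :
  (\int[mu]_(u in cube) (J_kernel k u)%:E)%E \is a fin_num.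
Proof.
by apply: integrable_fin_num; [exact: measurable_unit_cube|exact: integrable_J_kernel].
Qed.

Lemma layer_integral_cvg k : \sum_(0 <= l < N) layer_integral k l @[N --> \oo] -->
  fine (\int[mu]_(u in cube) (J_kernel k u)%:E)%E.
Proof.
have : (fun N => \sum_(0 <= l < N) (layer_integral k l)%:E)%E @ \oo -->
    (fine (\int[mu]_(u in cube) (J_kernel k u)%:E)%E)%:E.
  rewrite fineK ?integral_J_kernel_fin// integral_J_kernel.
  by apply: is_cvg_nneseries => l _ _; rewrite lee_fin layer_integral_ge0.
move/fine_cvg; apply: cvg_trans; apply: near_eq_cvg; apply: nearW => N.
by rewrite /= sumEFin.
Qed.

Lemma integral_J_integrand n :
  fine (\int[mu]_(u in cube) (J_integrand r n u)%:E)%E =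
  \sum_(k < n.+1) (-1) ^+ k * 'C(n, k)%:R *
    fine (\int[mu]_(u in cube) (J_kernel k u)%:E)%E.
Proof.
have mc : measurable cube by exact: measurable_unit_cube.
pose f (k : 'I_n.+1) u := (((-1) ^+ k * 'C(n, k)%:R)%:E * (EFin \o J_kernel k) u)%E.
rewrite (eq_integral (fun u => \sum_(k < n.+1) f k u)%E); last first.
  by move=> u _; rewrite J_integrand_J_kernel -sumEFin; apply: eq_bigr => k _; rewrite EFinM.
rewrite integral_sum//; last first.
  by move=> k; apply: integrableZl => //; exact: integrable_J_kernel.
under eq_bigr => k _.
  rewrite /f integralZl//; last exact: integrable_J_kernel.
  rewrite /= -(fineK (integral_J_kernel_fin k)) -EFinM.
  over.
by rewrite sumEFin.
Qed.

End J_terms.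

(** * Even moments and the normalized numbers of even index *)

Section even_moments.
Variable R : realType.
Local Open Scope classical_set_scope.

(** The dimension is m + 2, so that m is the exponent of y in the generating series. *)
Definition kernel_integral (k m : nat) : R := \sum_(1 <= r < m.+2)
  fine (\int[lebesgue_tuple R m.+2]_(u in unit_cube R m.+2) (J_kernel r k u)%:E)%E.

Lemma fps_signM (f : fps R) j n : ((-1) ^+ j * f) n = (-1) ^+ j * f n.
Proof.
by rewrite -signr_odd -[in RHS]signr_odd; case: (odd j); rewrite ?expr1 ?expr0 ?mulN1r ?mul1r.
Qed.

(** In the product of two inverse nodes, the coefficient of y^m is a sum over i <= m whose i-th term
    is the integral for r = i + 1. *)
Lemma hahn_term_coef k l m :
  hahn_term (@inv_node R) k l m = \sum_(1 <= r < m.+2) layer_integral R m.+2 r k l.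
Proof.
have /(congr1 (@^~ m)) := hahn_termE (@inv_nodeK R) k l.
rewrite !fps_natM => /mulfI <-; last by rewrite pnatr_eq0.
rewrite fps_sum mulr_sumr big_add1 big_mkord [RHS]exchange_big.
apply: eq_bigr => j _; rewrite -mulrA fps_signM fps_natM fpsM mulrA !mulr_sumr /=.
apply: eq_bigr => i _; rewrite /layer_coef /inv_node.
have -> : (m.+2 - i.+1 = (m - i).+1)%N by have := ltn_ord i; lia.
by rewrite !mulrA.
Qed.

Lemma hahn_sum_cvg k m :
  \sum_(0 <= l < N) hahn_term (@inv_node R) k l m @[N --> \oo] --> kernel_integral k m.
Proof.
have -> : (fun N => \sum_(0 <= l < N) hahn_term (@inv_node R) k l m) =
    fun N => \sum_(1 <= r < m.+2 | (1 <= r < m.+2)%N)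
      \sum_(0 <= l < N) layer_integral R m.+2 r k l.
  apply/funext => N; under eq_bigr do rewrite hahn_term_coef.
  by rewrite exchange_big big_nat.
rewrite /kernel_integral big_nat; apply: cvg_big => [|r /andP[r0 rm]].
  exact: add_continuous.
exact: layer_integral_cvg.
Qed.

Lemma J_kernel_integral n m : J R m.+2 n =
  2 ^+ m.+2 * \sum_(k < n.+1) (-1) ^+ k * 'C(n, k)%:R * kernel_integral k m.
Proof.
transitivity (\sum_(1 <= r < m.+2) 2 ^+ m.+2 *
   fine (\int[lebesgue_tuple R m.+2]_(u in unit_cube R m.+2) (J_integrand r n u)%:E)%E).
  by [].
rewrite -mulr_sumr; congr (_ * _); rewrite /kernel_integral.
under [RHS]eq_bigr do rewrite mulr_sumr.
rewrite [RHS]exchange_big !big_nat; apply: eq_bigr => r /andP[r0 rm] /=.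
exact: integral_J_integrand.
Qed.

(** The power of 2 comes from J and implements the substitution z = y / 2, whence the coefficient 4
    in [momentS]. *)
Definition moment k s : R := 2 ^+ s.*2.+2 * kernel_integral k s.*2.

Lemma momentS k s : k.*2.+2%:R ^+ 2 * moment k.+1 s =
  k.*2.+1%:R ^+ 2 * moment k s - (if s is s'.+1 then 4 * moment k s' else 0).
Proof.
have s1 : s.*2 != 1%N by apply/eqP => /(congr1 odd); rewrite odd_double.
have := hahn_sum_rec hahn_sum_cvg k s1.
rewrite /moment mulrCA => ->; case: s {s1} => [|s]; first by rewrite /=; ring.
by rewrite doubleS 2!exprS; ring.
Qed.

Definition hahn_poly k : {poly rat} := central_weight k *: hahn_factor 1 k.

Lemma hahn_poly_coefS k j : k.*2.+2%:R ^+ 2 * (hahn_poly k.+1)`_j =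
  k.*2.+1%:R ^+ 2 * (hahn_poly k)`_j
  - (if j is j'.+1 then 4 * (hahn_poly k)`_j' else 0).
Proof.
have n1 : k.*2.+1%:R != 0 :> rat by rewrite pnatr_eq0.
have n2 : k.*2.+2%:R != 0 :> rat by rewrite pnatr_eq0.
rewrite /hahn_poly central_weightS /hahn_factor big_nat_recr//= !coefZ mulrBr mulr1.
rewrite coefB -scalerAr coefZ coefMX mulr1.
set a := k.*2.+1%:R in n1 *; set b := k.*2.+2%:R in n2 *.
set w := central_weight k; set P := \prod_(0 <= i < k) _.
by clearbody a b; case: j => [|j] /=; rewrite ?coefZ; field; rewrite n1 n2.
Qed.

(** As series in z^2, the moments of H_k are [hahn_poly k] times those of H_0: both sides satisfy
    the same recurrence in k. *)
Lemma moment_hahn_poly k s :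
  moment k s = \sum_(j < s.+1) ratr (hahn_poly k)`_j * moment 0 (s - j).
Proof.
elim: k s => [|k IH] s.
  have h0 : hahn_poly 0 = 1.
    rewrite /hahn_poly /hahn_factor big_geq// /central_weight bin0 expn0.
    by rewrite divff ?scale1r.
  rewrite h0 big_ord_recl subn0 coef1 rmorph1 mul1r big1 ?addr0// => i _.
  by rewrite coef1 lift0 rmorph0 mul0r.
have k0 : k.*2.+2%:R ^+ 2 != 0 :> R by rewrite expf_neq0 ?pnatr_eq0.
apply: (mulfI k0); rewrite momentS mulr_sumr.
transitivity (\sum_(j < s.+1)
    ratr (k.*2.+2%:R ^+ 2 * (hahn_poly k.+1)`_j) * moment 0 (s - j)); last first.
  by apply: eq_bigr => j _; rewrite rmorphM rmorphXn /= ratr_nat [RHS]mulrA.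
under [RHS]eq_bigr do rewrite hahn_poly_coefS rmorphB /= mulrBl rmorphM rmorphXn /= ratr_nat.
rewrite sumrB; congr (_ - _).
  by rewrite IH mulr_sumr; apply: eq_bigr => j _; rewrite mulrA.
rewrite big_ord_recl /= rmorph0 mul0r add0r; case: s => [|s].
  by rewrite big_ord0.
rewrite IH mulr_sumr; apply: eq_bigr => j _.
by rewrite rmorphM /= ratr_nat mulrA.
Qed.

Lemma apery_poly_coef n j : (apery_poly 1 n)`_j =
  \sum_(k < n.+1) (-1) ^+ k * 'C(n, k)%:R * (hahn_poly k)`_j.
Proof.
rewrite /apery_poly big_mkord coef_sum; apply: eq_bigr => k _.
by rewrite /hahn_poly !coefZ [RHS]mulrA.
Qed.

Lemma J0_moment s : J R s.*2.+2 0 = moment 0 s.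
Proof. by rewrite J_kernel_integral big_ord1 expr0 bin0 !mul1r. Qed.

Lemma J_apery_poly n s : J R s.*2.+2 n =
  \sum_(0 <= j < s.+1) J R (s - j).*2.+2 0 * ratr (apery_poly 1 n)`_j.
Proof.
rewrite J_kernel_integral mulr_sumr big_mkord.
transitivity (\sum_(k < n.+1) \sum_(j < s.+1)
   ((-1) ^+ k * 'C(n, k)%:R) * (ratr (hahn_poly k)`_j * moment 0 (s - j))).
  apply: eq_bigr => k _; rewrite mulrCA -/(moment k s) moment_hahn_poly.
  by rewrite mulr_sumr.
rewrite [LHS]exchange_big; apply: eq_bigr => j _.
rewrite J0_moment apery_poly_coef rmorph_sum mulr_sumr; apply: eq_bigr => k _ /=.
by rewrite !rmorphM /= rmorphXn rmorphN1 ratr_nat; ring.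
Qed.

(** This is the diagonal entry of the triangular system defining the normalized numbers. It is
    positive because the layer l = 0 contributes 1. *)
Lemma J20_neq0 : J R 2 0 != 0.
Proof.
rewrite (J0_moment 0) /moment mulf_neq0 ?expf_neq0 ?pnatr_eq0//.
rewrite /kernel_integral big_nat1 gt_eqF//.
have c := @layer_integral_cvg R 2 1 isT isT 0.
rewrite -(cvg_lim (@Rhausdorff R) c).
apply: (@lt_le_trans _ _ (\sum_(0 <= l < 1) layer_integral R 2 1 0 l)).
  by rewrite big_nat1 layer_integral0// expr1n invr1.
apply: (@nondecreasing_cvgn_le _ (fun N => \sum_(0 <= l < N) layer_integral R 2 1 0 l)).
  by apply/nondecreasing_seqP => N; rewrite big_nat_recr//= lerDl layer_integral_ge0.
by apply: cvgP c.
Qed.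

(** By [J_apery_poly] the coefficients of b_n solve the same triangular system, and its solution is
    unique. *)
Lemma normalized_J_apery (tJ : nat -> nat -> R) s n : normalized_J tJ ->
  tJ s.*2.+2 n = ratr (apery_poly 1 n)`_s.
Proof.
move=> [_ hJ _]; elim/ltn_ind: s => s IH.
have := hJ s.+1 n isT; rewrite doubleS J_apery_poly !big_nat_recr// subnn.
have -> : (s.*2.+2 - s.*2 = 2)%N by lia.
rewrite (@eq_big_nat _ _ _ 0 s _ (fun j => J R (s.*2.+2 - j.*2) 0 * tJ j.*2.+2 n)).
  by move/addrI/(mulfI J20_neq0).
move=> j /andP[_ js]; rewrite IH// (_ : (s - j).*2.+2 = s.*2.+2 - j.*2)%N//.
lia.
Qed.

End even_moments.

(** * Rescaled coefficients and p-adic valuations *)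

Lemma hahn_factor_coef c k s : (hahn_factor c k)`_s = c ^+ s * (hahn_factor 1 k)`_s.
Proof.
elim: k s => [|k IH] s.
  by rewrite /hahn_factor !big_geq// coef1; case: s => [|s]; rewrite ?expr0 ?mulr0 ?mulr1.
rewrite /hahn_factor !big_nat_recr//= -!/(hahn_factor _ k) !mulrBr !mulr1 !coefB.
rewrite -!scalerAr !coefZ !coefMX IH; case: s => [|s] /=; first by ring.
by rewrite IH exprS; ring.
Qed.

Lemma apery_poly_scale c N s : (apery_poly c N)`_s = c ^+ s * (apery_poly 1 N)`_s.
Proof.
rewrite /apery_poly !coef_sum mulr_sumr; apply: eq_bigr => k _.
by rewrite !coefZ hahn_factor_coef mulrCA.
Qed.

(** After cross-multiplication valuations are compared: the denominator of [c] is prime to [p] and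
    the numerator of [c] can only add to [n]. *)
Lemma congr_rat_p_integral p n a b c : prime p -> c \in p_integral p ->
  a - b = p%:R ^+ n * c -> congr_rat p n a b.
Proof.
move=> pp pc ab; have [/eqP|d0] := eqVneq (a - b) 0.
  by rewrite subr_eq0 => /eqP ->; left.
right; set d := a - b in ab d0 *.
have c0 : c != 0 by apply: contraNneq d0 => c0; rewrite ab c0 mulr0.
have : numq d * denq c = (p ^ n)%:Z * (numq c * denq d).
  apply/eqP; rewrite -(eqr_int rat) !rmorphM /= !numqE ab.
  by rewrite -pmulrn natrX; apply/eqP; ring.
move/(congr1 absz); rewrite !abszM absz_nat => /(congr1 (logn p)).
have nd : (0 < `|numq d|)%N by rewrite absz_gt0 numq_eq0.
have nc : (0 < `|numq c|)%N by rewrite absz_gt0 numq_eq0.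
have dd : (0 < `|denq d|)%N by rewrite absz_gt0 denq_eq0.
have dc : (0 < `|denq c|)%N by rewrite absz_gt0 denq_eq0.
have pn : (0 < p ^ n)%N by rewrite expn_gt0 prime_gt0.
rewrite !lognM ?muln_gt0 ?nc ?dd// pfactorK//.
rewrite (logn_coprime pc) addn0 /padic_val => ->.
lia.
Qed.

Theorem theorem3p16 (R : realType) (tJ : nat -> nat -> R) (p m n s : nat)
  (hJ : normalized_J tJ)
  (hp : prime p) (p_odd : odd p)
  (hm : (1 <= m)%N) (hmp : (m.*2 < p)%N)
  (hn : (1 <= n)%N) (hs : (1 <= s)%N) :
  congr_mod_pow p n
    (p%:R ^+ (2 * s * n) * tJ (2 * s + 2)%N (m * p ^ n)%N)
    (p%:R ^+ (2 * s * (n - 1)) * tJ (2 * s + 2)%N (m * p ^ (n - 1))%N).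
Proof.
case: n hn => // n _; rewrite subSS subn0.
have -> : (2 * s + 2 = s.*2.+2)%N by rewrite mul2n addn2.
rewrite !(normalized_J_apery _ _ hJ).
(* The factor p^(2sk) is the s-th power of p^(2k), hence the effect on the s-th coefficient of
   rescaling z^2 by p^(2k). *)
have E k : p%:R ^+ (2 * s * k) * ratr (apery_poly 1 (m * p ^ k))`_s =
    ratr (apery_poly (p%:R ^+ k.*2) (m * p ^ k))`_s :> R.
  rewrite [in RHS]apery_poly_scale rmorphM !rmorphXn /= ratr_nat -exprM; congr (_ ^+ _ * _).
  by rewrite -mul2n; ring.
rewrite !E; eexists; eexists; split; [by []|by []|].
have [h /polyOverP ph e] := apery_poly_prime n hp p_odd hm hmp.
apply: (congr_rat_p_integral hp (ph s)).
by rewrite -coefB e coefZ.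
Qed.
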